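(* Let $D$ be a linear differential operator of order $k\ge 0$, and let $K:\Omega\times\Omega\to\mathbb{R}$ be a symmetric conditionally positive definite kernel of order $s\ge 0$ on a domain $\Omega\subset\mathbb{R}^d$. Let $\mathbf{z}\in\Omega$ and let $\mathbf{X}=\{\mathbf{x}_1,\ldots,\mathbf{x}_N\}$ be a finite set of (distinct) points such that $S_{\mathbf{z},\mathbf{X}}:=\bigcup_{i=1}^N[\mathbf{z},\mathbf{x}_i]\subset\Omega$. Assume that there is at least one $w\in\mathbb{R}^N$ with $\sum_{j=1}^N w_j p(\mathbf{x}_j)=Dp(\mathbf{z})$ for all $p\in\Pi^d_s$, and that for some integer $r\ge k$ and some $\gamma\in(0,1]$ the kernel $K$ possesses continuous partial derivatives $\partial^{\alpha,\beta}K(\mathbf{x},\mathbf{y})$ for all $|\alpha|,|\beta|\le r$ and all $\mathbf{x},\mathbf{y}\in S_{\mathbf{z},\mathbf{X}}$, and $|K|_{\mathbf{z},\mathbf{X},r+\gamma}<\infty$. Let $w^*=(w_1^*,\ldots,w_N^* )$ be the weight vector of the kernel-based numerical differentiation formula for $D$, $K$, $s$, $\mathbf{z}$, $\mathbf{X}$. Then for all $f\in\mathcal{F}_K$, $$\Big|Df(\mathbf{z})-\sum_{j=1}^N w_j^* f(\mathbf{x}_j)\Big|\le \rho_{q,D}(\mathbf{z},\mathbf{X},r+\gamma)\,|K|_{\mathbf{z},\mathbf{X},r+\gamma}^{1/2}\,\|f\|_K,\qquad q=\max\{s,r+1\}.$$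
   Context: Notation. $\Pi^d_q$ is the space of $d$-variate real polynomials of total degree at most $q-1$ ($\Pi^d_0=\{0\}$). $[\mathbf{z},\mathbf{x}]$ is the closed line segment between $\mathbf{z}$ and $\mathbf{x}$. Differential operator: $Df=\sum_{|\alpha|\le k}a_\alpha\partial^\alpha f$ with real variable coefficients $a_\alpha$ (functions). $D'K$ denotes $D$ applied to the first $d$-dimensional argument of $K$. $\partial^{\alpha,\beta}K(\mathbf{x},\mathbf{y})=\frac{\partial^{|\alpha|}}{\partial\mathbf{x}^\alpha}\frac{\partial^{|\beta|}}{\partial\mathbf{y}^\beta}K(\mathbf{x},\mathbf{y})$ (used when the order of differentiation does not influence the result). A symmetric kernel $K$ is conditionally positive definite of order $s$ on $\Omega$ if $\sum_{i,j=1}^n a_ia_jK(\mathbf{y}_i,\mathbf{y}_j)>0$ for all pairwise distinct $\mathbf{y}_1,\ldots,\mathbf{y}_n\in\Omega$ and all $a\in\mathbb{R}^n\setminus\{0\}$ with $\sum_j a_jp(\mathbf{y}_j)=0$ for all $p\in\Pi^d_s$ (for $s=0$: strictly positive definite). Kernel-based formula. Let $p_1,\ldots,p_M$ be a basis of $\Pi^d_s$ ($M=\binom{d+s-1}{d}$, and $M=0$ if $s=0$). The weight vector $w^*$ is the $w$-part of a solution $(w,v)\in\mathbb{R}^N\times\mathbb{R}^M$ of $$\sum_{j=1}^N w_jK(\mathbf{x}_i,\mathbf{x}_j)+\sum_{j=1}^M v_jp_j(\mathbf{x}_i)=D'K(\mathbf{z},\mathbf{x}_i)\ (1\le i\le N),\qquad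 \sum_{j=1}^N w_jp_i(\mathbf{x}_j)=Dp_i(\mathbf{z})\ (1\le i\le M).$$ It is known that if the second group of equations is consistent, then the whole system is solvable and $w^*$ is uniquely determined ($v$ may be non-unique). Native space. $\mathcal{F}_K$ is the semi-Hilbert space of real-valued functions on $\Omega$ obtained as completion of the space of functions $\sum_i a_iK(\cdot,\mathbf{y}_i)+p$ (finite sums, $\mathbf{y}_i\in\Omega$, $p\in\Pi^d_s$, $\sum_i a_iq(\mathbf{y}_i)=0$ for all $q\in\Pi^d_s$) with squared semi-norm $\|\sum_i a_iK(\cdot,\mathbf{y}_i)+p\|_K^2=\sum_{i,j}a_ia_jK(\mathbf{y}_i,\mathbf{y}_j)$; polynomials in $\Pi^d_s$ have semi-norm zero. Equivalently, $f:\Omega\to\mathbb{R}$ belongs to $\mathcal{F}_K$ with $\|f\|_K\le C$ iff $|\sum_i a_if(\mathbf{y}_i)|\le C(\sum_{i,j}a_ia_jK(\mathbf{y}_i,\mathbf{y}_j))^{1/2}$ for all finite sets of points $\mathbf{y}_i\in\Omega$ and coefficients $a_i$ with $\sum_i a_iq(\mathbf{y}_i)=0$ for all $q\in\Pi^d_s$. Growth function. For $\mu\ge0$, $\rho_{q,D}(\mathbf{z},\mathbf{X},\mu):=\sup\{Dp(\mathbf{z}):p\in\Pi^d_q,\ |p(\mathbf{x}_j)|\le\|\mathbf{x}_j-\mathbf{z}\|_2^\mu,\ j=1,\ldots,N\}\in[0,\infty]$; if it equals $\infty$ the bound is void. Kernel seminorms. For $U:S_{\mathbf{z},\mathbf{X}}\times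 S_{\mathbf{z},\mathbf{X}}\to\mathbb{R}$ and $0<\gamma\le1$, $$|U|_{\mathbf{z},\mathbf{X},\gamma}:=\sup_{\mathbf{x},\mathbf{y}\in S_{\mathbf{z},\mathbf{X}},\ \mathbf{x}\ne\mathbf{z},\,\mathbf{y}\ne\mathbf{z}}\frac{|U(\mathbf{x},\mathbf{y})-U(\mathbf{x},\mathbf{z})-U(\mathbf{z},\mathbf{y})+U(\mathbf{z},\mathbf{z})|}{\|\mathbf{x}-\mathbf{z}\|_2^\gamma\|\mathbf{y}-\mathbf{z}\|_2^\gamma},$$ and for integers $r\ge1$, $$|U|_{\mathbf{z},\mathbf{X},r+\gamma}:=\frac{1}{(\gamma+1)^2\cdots(\gamma+r)^2}\Big(\sum_{|\alpha|=r}\sum_{|\beta|=r}\binom{r}{\alpha}\binom{r}{\beta}|\partial^{\alpha,\beta}U|_{\mathbf{z},\mathbf{X},\gamma}^2\Big)^{1/2},\qquad \binom{r}{\alpha}=\frac{r!}{\alpha!}.$$ *)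

(* Defs.v *)
From HB Require Import structures.
From mathcomp Require Import all_boot all_order all_algebra.
From mathcomp Require Import all_classical all_reals all_analysis.

Set Implicit Arguments.
Unset Strict Implicit.
Unset Printing Implicit Defensive.

Import Order.TTheory GRing.Theory Num.Theory.
Import numFieldNormedType.Exports.

Local Open Scope classical_set_scope.
Local Open Scope ring_scope.

Section Defs.
Context {R : realType} {d : nat}.
Local Notation V := 'rV[R]_d.

(* The library norm of 'rV_d is the sup norm; it induces the same topology. *)
Definition norm2 (x : V) : R := Num.sqrt (\sum_(i < d) x ord0 i ^+ 2).

Definition domain (Om : set V) : Prop := open Om /\ connected Om.

Definition segment (z x : V) : set V :=
  [set (1 - t) *: z + t *: x | t in [set t : R | 0 <= t <= 1]].

Definition star N (z : V) (x : 'I_N -> V) : set V :=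
  \bigcup_(i in [set: 'I_N]) segment z (x i).

(* Multi-indices are functions 'I_d -> nat. Finite sums over |al| <= n range
   over {ffun 'I_d -> 'I_n.+1}, filtered by |al|; [mi] forgets the bound. *)
Definition mi n (al : {ffun 'I_d -> 'I_n.+1}) : 'I_d -> nat :=
  fun i => al i.
Definition msize (al : 'I_d -> nat) : nat := (\sum_(i < d) al i)%N.
Definition mincr (al : 'I_d -> nat) (i : 'I_d) : 'I_d -> nat :=
  fun j => (al j + (j == i))%N.
Definition multinom (al : 'I_d -> nat) : R :=
  ((msize al)`!)%:R / (\prod_(i < d) (al i)`!)%:R.
Definition monomial (al : 'I_d -> nat) (x : V) : R :=
  \prod_(i < d) x ord0 i ^+ al i.

Definition polyspace (q : nat) : set (V -> R) :=
  [set p | exists c : {ffun 'I_d -> 'I_q.+1} -> R, forall x,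
     p x = \sum_(al | (msize (mi al) < q)%N) c al * monomial (mi al) x].

Definition polybasis (s M : nat) (p : 'I_M -> V -> R) : Prop :=
  [/\ forall j, polyspace s (p j),
      forall g, polyspace s g ->
        exists c : 'I_M -> R, forall x, g x = \sum_(j < M) c j * p j x
    & forall c : 'I_M -> R,
        (forall x, \sum_(j < M) c j * p j x = 0) -> forall j, c j = 0].

Definition pderiv (i : 'I_d) (f : V -> R) : V -> R :=
  fun x => 'D_(delta_mx ord0 i) f x.

Definition partial (al : 'I_d -> nat) (f : V -> R) : V -> R :=
  foldr (fun i g => iter (al i) (pderiv i) g) f (enum 'I_d).

Definition kpartial (al be : 'I_d -> nat) (K : V -> V -> R) : V -> V -> R :=
  fun x y => partial al (fun x' => partial be (K x') y) x.

(* [partial] is total, with an unspecified value where a limit does not exist;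
   this predicate says that the partial derivatives of f at x up to order k
   are genuine, each lower-order one being so throughout a neighbourhood. *)
Fixpoint has_partials (k : nat) (f : V -> R) (x : V) : Prop :=
  if k is k'.+1 then
    (\forall y \near x, has_partials k' f y) /\
    (forall al, msize al = k' ->
       forall i, derivable (partial al f) x (delta_mx ord0 i))
  else True.

(* The derivatives d^{al,be} K, |al|, |be| <= r, exist near every point of
   S x S and are continuous at every point of S x S. The two differentiation
   clauses also express that the order of differentiation is immaterial, which
   is part of the meaning of the notation d^{al,be}. *)
Definition has_continuous_kpartials (r : nat) (S : set V) (K : V -> V -> R)
  : Prop :=
  forall x y, S x -> S y ->
  forall al be, (msize al <= r)%N -> (msize be <= r)%N ->
  [/\ {for (x, y), continuous (fun u : V * V => kpartial al be K u.1 u.2)},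
      (msize al < r)%N -> forall i, \forall u \near (x, y),
        is_derive u.1 (delta_mx ord0 i) (fun x' => kpartial al be K x' u.2)
          (kpartial (mincr al i) be K u.1 u.2)
    & (msize be < r)%N -> forall i, \forall u \near (x, y),
        is_derive u.2 (delta_mx ord0 i) (fun y' => kpartial al be K u.1 y')
          (kpartial al (mincr be i) K u.1 u.2)].

Definition diffop (k : nat) (a : {ffun 'I_d -> 'I_k.+1} -> V -> R)
    (f : V -> R) : V -> R :=
  fun x => \sum_(al | (msize (mi al) <= k)%N) a al x * partial (mi al) f x.

Definition symmetric_on (Om : set V) (K : V -> V -> R) : Prop :=
  forall x y, Om x -> Om y -> K x y = K y x.

Definition annihilates s n (a : 'I_n -> R) (y : 'I_n -> V) : Prop :=
  forall p, polyspace s p -> \sum_(i < n) a i * p (y i) = 0.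

Definition kform (K : V -> V -> R) n (a : 'I_n -> R) (y : 'I_n -> V) : R :=
  \sum_(i < n) \sum_(j < n) a i * a j * K (y i) (y j).

Definition cond_posdef s (Om : set V) (K : V -> V -> R) : Prop :=
  forall n (y : 'I_n -> V) (a : 'I_n -> R),
    injective y -> (forall i, Om (y i)) -> (exists i, a i != 0) ->
    annihilates s a y -> 0 < kform K a y.

Definition kernel_weights k (a : {ffun 'I_d -> 'I_k.+1} -> V -> R)
    (K : V -> V -> R) (z : V) N (x : 'I_N -> V) M (p : 'I_M -> V -> R)
    (w : 'I_N -> R) : Prop :=
  exists v : 'I_M -> R,
    (forall i, \sum_(j < N) w j * K (x i) (x j) + \sum_(j < M) v j * p j (x i)
               = diffop a (fun u => K u (x i)) z) /\
    (forall i, \sum_(j < N) w j * p i (x j) = diffop a (p i) z).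

(* f belongs to the native space with semi-norm at most C. This is the concrete
   description, as functions on Om, of the completion of the kernel sums
   modulo polynomials. *)
Definition native_le s (Om : set V) (K : V -> V -> R) (f : V -> R) (C : R)
  : Prop :=
  0 <= C /\
  forall n (y : 'I_n -> V) (a : 'I_n -> R),
    (forall i, Om (y i)) -> annihilates s a y ->
    `|\sum_(i < n) a i * f (y i)| <= C * Num.sqrt (kform K a y).

Definition native_space s Om K : set (V -> R) :=
  [set f | exists C, native_le s Om K f C].

Definition native_norm s Om K (f : V -> R) : R :=
  inf [set C | native_le s Om K f C].

Definition growth q k (a : {ffun 'I_d -> 'I_k.+1} -> V -> R)
    (z : V) N (x : 'I_N -> V) (mu : R) : \bar R :=
  ereal_sup [set (diffop a p z)%:E | p in
    [set p | polyspace q p /\ forall j, `|p (x j)| <= norm2 (x j - z) `^ mu]].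

(* 0 is adjoined so that the supremum is 0, not -oo, when S = {z}. *)
Definition kseminorm0 (S : set V) (z : V) (gam : R) (U : V -> V -> R)
  : \bar R :=
  ereal_sup (0%E |` [set
    (`|U u.1 u.2 - U u.1 z - U z u.2 + U z z|
       / (norm2 (u.1 - z) `^ gam * norm2 (u.2 - z) `^ gam))%:E
    | u in [set u : V * V | [/\ S u.1, S u.2, u.1 != z & u.2 != z]]]).

(* [kseminorm S z r gam U] is |U|_{z,X,r+gam}. *)
Definition kseminorm (S : set V) (z : V) (r : nat) (gam : R) (U : V -> V -> R)
  : \bar R :=
  if r is 0%N then kseminorm0 S z gam U else
  (((\prod_(1 <= j < r.+1) (gam + j%:R) ^+ 2)^-1)%:E *
   sqrte (\sum_(al : {ffun 'I_d -> 'I_r.+1} | msize (mi al) == r)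
          \sum_(be : {ffun 'I_d -> 'I_r.+1} | msize (mi be) == r)
            (multinom (mi al) * multinom (mi be))%:E *
            kseminorm0 S z gam (kpartial (mi al) (mi be) U) ^+ 2))%E.

End Defs.

(* Main.v *)
(** Let [L g = Dg(z) - sum_j w_j g(x_j)].  Applying the defining inequality of
    the native space to difference quotients gives, for weights exact on
    polynomials of order [s], [|L f| <= ||f|| (L'L''K)^(1/2)]; to stay within
    functionals annihilating these polynomials, each quotient is corrected by a
    combination of point evaluations, which amounts to replacing [K] by a
    reduced kernel.  The kernel-based weights minimize [L'L''K] among all such
    weights, since [L'L''K] differs from its minimum by [sum u_i u_j K(x_i, x_j)].
    By duality of linear programming there are weights, exact on polynomials
    of order [q], with [sum_j |w_j| |x_j - z|^(r + gam)] at most the growth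
    function.  For these, two Taylor expansions at [z], one in each argument of
    [K], bound [L'L''K] by the square of that sum times the seminorm of [K]. *)
Require Import Defs.
From HB Require Import structures.
From mathcomp Require Import all_boot all_order all_algebra.
From mathcomp Require Import all_classical all_reals all_analysis.
From mathcomp Require Import ring lra.
Import Order.TTheory GRing.Theory Num.Theory.
Import numFieldNormedType.Exports.
Local Open Scope classical_set_scope.
Local Open Scope ring_scope.

Set Implicit Arguments.
Unset Strict Implicit.
Unset Printing Implicit Defensive.

(** Two obstacles shape the argument. Only inequalities between point values of [f] are given, so
    the existence of its derivatives must itself be proved: the difference of two quotients with
    steps [h1] and [h2] is controlled by four mixed second differences of the kernel, all with the
    same limit, and the quotients therefore form a Cauchy family. Moreover, continuity of kernel
    derivatives is assumed at points of [S x S] only. Derivatives below order [r] are treated on an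
    open neighbourhood [W] of the nodes, where bounds on one further derivative replace continuity;
    those of order [r] are treated at the nodes alone. The two terms of [q] serve different ends:
    exactness on order [s] makes the weights comparable with the minimizing ones, exactness on order
    [r + 1] removes the Taylor polynomials. Each expansion divides by the product of the [gam + j],
    hence the squares in the seminorm, and its multinomial weights come from Cauchy-Schwarz combined
    with the multinomial theorem. *)

Section Duality.

(** * Linear programming duality for finitely many constraints *)

Context {R : realType} {V : lmodType R}.

Lemma scalar_facts (f : V -> R) : scalar f ->
  [/\ f 0 = 0, forall a u, f (a *: u) = a * f u & forall u v, f (u + v) = f u + f v].
Proof.
move=> fl; have fD u v : f (u + v) = f u + f v.
  by rewrite -[u in LHS]scale1r fl mul1r.
have f0 : f 0 = 0 by apply: (addrI (f 0)); rewrite -fD !addr0.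
by split=> // a u; rewrite -[_ *: u]addr0 fl f0 addr0.
Qed.

(* [t] is the slope of a line through [(c, rho)] lying above all the points
   [(phi v, L v)]: the supremum of the slopes from that point to those on its
   right. *)
Lemma exists_multiplier (S : set V) (phi L : V -> R) (c rho : R) (v0 : V) :
  (forall u v (l : R), S u -> S v -> 0 <= l <= 1 -> S (l *: u + (1 - l) *: v)) ->
  (forall v, S v -> S (- v)) ->
  scalar phi -> scalar L -> 0 <= c ->
  (forall v, S v -> `|phi v| <= c -> L v <= rho) ->
  S v0 -> rho < L v0 -> c < phi v0 ->
  exists2 t, 0 <= t & forall v, S v -> L v - rho <= t * (phi v - c).
Proof.
move=> Sconv Sopp phil Ll c0 H Sv0 Lv0 phiv0.
have [_ phiZ phiD] := scalar_facts phil; have [_ LZ LD] := scalar_facts Ll.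
have slope u v : S u -> S v -> c < phi u -> phi v < c ->
    (L u - rho) / (phi u - c) <= (rho - L v) / (c - phi v).
  move=> Su Sv cu vc.
  have uc0 : 0 < phi u - c by rewrite subr_gt0.
  have cv0 : 0 < c - phi v by rewrite subr_gt0.
  have uv0 : 0 < phi u - phi v by lra.
  (* The weight that puts [l *: u + (1 - l) *: v] on the hyperplane [phi = c], where [L] is at most
     [rho]. *)
  pose l := (c - phi v) / (phi u - phi v).
  have l01 : 0 <= l <= 1.
    rewrite divr_ge0 ?(ltW cv0) ?(ltW uv0)//= ler_pdivrMr// mul1r; lra.
  have := H _ (Sconv u v l Su Sv l01); rewrite phiD LD !phiZ !LZ.
  have -> : l * phi u + (1 - l) * phi v = c by rewrite /l; field; rewrite gt_eqF.
  rewrite ger0_norm// => /(_ (lexx _)) Hl.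
  rewrite ler_pdivrMr// mulrAC ler_pdivlMr//.
  have : (l * L u + (1 - l) * L v) * (phi u - phi v) <= rho * (phi u - phi v).
    by rewrite ler_wpM2r// ltW.
  have -> : (l * L u + (1 - l) * L v) * (phi u - phi v) =
    (c - phi v) * L u + (phi u - c) * L v by rewrite /l; field; rewrite gt_eqF.
  lra.
pose E := [set (L v - rho) / (phi v - c) | v in [set v | S v /\ c < phi v]].
have E0 : E !=set0 by exists ((L v0 - rho) / (phi v0 - c)); exists v0.
have subE u : S u -> phi u < c -> ubound E ((rho - L u) / (c - phi u)).
  by move=> Su uc _ [v [Sv cv] <-]; exact: slope.
(* The point [- v0] satisfies [phi < - c <= c], so it lies on the left and bounds all the slopes. *)
have supE : has_sup E.
  split=> //; exists ((rho - L (- v0)) / (c - phi (- v0))); apply: subE.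
    exact: Sopp.
  by rewrite -scaleN1r phiZ; lra.
exists (sup E).
  have /le_trans : 0 <= (L v0 - rho) / (phi v0 - c) by apply: divr_ge0; lra.
  by apply; apply: ub_le_sup; [case: supE | exists v0].
move=> v Sv; have [vc|cv|vc] := ltgtP (phi v) c.
- have : sup E <= (rho - L v) / (c - phi v) by apply: ge_sup => //; exact: subE.
  rewrite ler_pdivlMr ?subr_gt0//; lra.
- rewrite -ler_pdivrMr ?subr_gt0//; apply: ub_le_sup; first by case: supE.
  by exists v.
- rewrite vc subrr mulr0 subr_le0; apply: H => //; rewrite vc ger0_norm//.
Qed.

(* Induction on [N]: the last constraint is removed at the price of replacing
   [L] by [L - t phi] for a multiplier [t]. *)
Lemma linear_sum_duality N (phi : 'I_N -> V -> R) (c : 'I_N -> R) (L : V -> R)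
    (rho : R) :
  (forall j, scalar (phi j)) -> scalar L -> (forall j, 0 <= c j) ->
  (forall v, (forall j, `|phi j v| <= c j) -> L v <= rho) ->
  exists w : 'I_N -> R,
    (forall v, L v = \sum_(j < N) w j * phi j v) /\
    \sum_(j < N) `|w j| * c j <= rho.
Proof.
elim: N phi c L rho => [|N IHN] phi c L rho phil Ll c0 Hrho.
  have [L0 LZ LD] := scalar_facts Ll.
  exists (fun=> 0); split; last first.
    by rewrite big_ord0 -L0; apply: Hrho => -[].
  (* Without constraints a linear form bounded above vanishes: otherwise some multiple of [v] has
     value [|rho| + 1]. *)
  move=> v; rewrite big_ord0; apply/eqP; apply: contraT => Lv0.
  have : L (((`|rho| + 1) / L v) *: v) <= rho by apply: Hrho => -[].
  rewrite LZ divfK//; have := ler_norm rho; lra.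
have [L0 LZ LD] := scalar_facts Ll.
pose S := [set v | forall j : 'I_N, `|phi (widen_ord (leqnSn N) j) v| <=
                                      c (widen_ord (leqnSn N) j)].
pose ph := phi ord_max; pose cm := c ord_max.
have Hrho' v : S v -> `|ph v| <= cm -> L v <= rho.
  move=> Sv pv; apply: Hrho => j; have [jN|jN] := ltnP j N.
    by have := Sv (Ordinal jN); congr (`|phi _ v| <= c _); apply: val_inj.
  suff -> : j = ord_max by [].
  by apply: val_inj; apply/eqP; rewrite eqn_leq jN -ltnS ltn_ord.
have Sconv u v (l : R) : S u -> S v -> 0 <= l <= 1 -> S (l *: u + (1 - l) *: v).
  move=> Su Sv /andP[l0 l1] j; have [_ pZ pD] := scalar_facts (phil (widen_ord (leqnSn N) j)).
  rewrite pD !pZ (le_trans (ler_normD _ _))// !normrM (ger0_norm l0).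
  have l0' : 0 <= 1 - l by lra.
  rewrite (ger0_norm l0').
  by have := ler_wpM2l l0 (Su j); have := ler_wpM2l l0' (Sv j); lra.
have Sopp v : S v -> S (- v).
  move=> Sv j; have [_ pZ pD] := scalar_facts (phil (widen_ord (leqnSn N) j)).
  by rewrite -scaleN1r pZ mulN1r normrN.
(* The multiplier costs [|t| * cm], which is deducted from the bound left to the induction
   hypothesis. If [L] exceeds [rho] somewhere on [S], the sign of [ph] there decides the sign of
   [t]. *)
have [t Ht] : exists t, forall v, S v -> L v - t * ph v <= rho - `|t| * cm.
  have [HS|] := pselect (forall v, S v -> L v <= rho).
    by exists 0 => v Sv; rewrite normr0 !mul0r !subr0 HS.
  move=> /existsNP[v0 /not_implyP[Sv0 /negP]]; rewrite -ltNge => Lv0.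
  have : cm < `|ph v0|.
    by rewrite ltNge; apply/negP => /(Hrho' _ Sv0); rewrite leNgt Lv0.
  rewrite real_ltr_normr ?num_real// => /orP[pv0|pv0].
    have [t t0 Ht] := exists_multiplier Sconv Sopp (phil _) Ll (c0 _) Hrho' Sv0 Lv0 pv0.
    exists t => v Sv; rewrite (ger0_norm t0); have := Ht v Sv; rewrite /ph /cm; lra.
  have phN : scalar (fun v => - ph v) by move=> b u v; rewrite /ph phil; ring.
  have Hrho'' v : S v -> `|- ph v| <= cm -> L v <= rho by rewrite normrN; exact: Hrho'.
  have [t t0 Ht] := exists_multiplier Sconv Sopp phN Ll (c0 _) Hrho'' Sv0 Lv0 pv0.
  exists (- t) => v Sv; rewrite normrN (ger0_norm t0); have := Ht v Sv; rewrite /ph /cm; lra.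
have [||||w [wL wc]] := IHN (fun j => phi (widen_ord (leqnSn N) j))
  (fun j => c (widen_ord (leqnSn N) j)) (fun v => L v - t * ph v) (rho - `|t| * cm).
- by move=> j; exact: phil.
- by move=> b u v; rewrite Ll /ph phil; ring.
- by move=> j; exact: c0.
- by move=> v Sv; exact: Ht.
exists (fun j : 'I_N.+1 => if ltnP j N is LtnNotGeq jN then w (Ordinal jN) else t).
have e j : (if ltnP (widen_ord (leqnSn N) j) N is LtnNotGeq jN then w (Ordinal jN) else t) = w j.
  case: ltnP => [jN|]; first by congr w; apply: val_inj.
  by rewrite leqNgt /= ltn_ord.
have em : (if ltnP (@ord_max N) N is LtnNotGeq jN then w (Ordinal jN) else t) = t.
  by case: ltnP => // jN; have := jN; rewrite ltnn.
split=> [v|]; rewrite big_ord_recr /= em.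
  under eq_bigr do rewrite e.
  by rewrite -wL -/ph subrK.
under eq_bigr do rewrite e.
by rewrite -lerBrDr.
Qed.
End Duality.

(** * Directional derivatives, mean values and one-variable Taylor remainders *)

Section Calculus.
Context {R : realType}.

Section Pointwise.
Context {V : normedModType R}.
Implicit Types (f g : V -> R) (x v : V).

Lemma is_deriveP f x v D :
  is_derive x v f D <-> h^-1 * (f (x + h *: v) - f x) @[h --> 0^'] --> D.
Proof.
have E : (fun h : R => h^-1 * (f (x + h *: v) - f x)) =
         (fun h : R => h^-1 *: ((f \o shift x) (h *: v) - f x)).
  by apply/funext => h; rewrite /= [x + _]addrC.
rewrite E; split=> [[df <-] //|fD]; apply: DeriveDef.
  by apply/cvg_ex; exists D; exact: fD.
by apply: cvg_lim; [exact: Rhausdorff | exact: fD].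
Qed.

Lemma derivableE f x v :
  derivable f x v <-> cvg (h^-1 * (f (x + h *: v) - f x) @[h --> 0^']).
Proof.
split=> [/derivableP/is_deriveP fD|/cvg_ex[D /is_deriveP[]//]].
by apply/cvg_ex; eexists; exact: fD.
Qed.

Lemma is_derive_add f g x v D E : is_derive x v f D -> is_derive x v g E ->
  is_derive x v (fun y => f y + g y) (D + E).
Proof. exact: is_deriveD. Qed.

Lemma is_derive_sub f g x v D E : is_derive x v f D -> is_derive x v g E ->
  is_derive x v (fun y => f y - g y) (D - E).
Proof. exact: is_deriveB. Qed.

Lemma is_derive_scale c f x v D : is_derive x v f D ->
  is_derive x v (fun y => c * f y) (c * D).
Proof. exact: is_deriveZ. Qed.

Lemma is_derive_scaler c f x v D : is_derive x v f D ->
  is_derive x v (fun y => f y * c) (D * c).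
Proof.
move=> fD; rewrite mulrC (_ : (fun y => _) = (fun y => c * f y)).
  exact: is_derive_scale.
by apply/funext => y; rewrite mulrC.
Qed.

Lemma is_derive_big (I : Type) (s : seq I) (P : pred I) (h : I -> V -> R)
    (dh : I -> R) x v :
  (forall i, P i -> is_derive x v (h i) (dh i)) ->
  is_derive x v (fun y => \sum_(i <- s | P i) h i y) (\sum_(i <- s | P i) dh i).
Proof.
move=> H; elim: s => [|i s IHs].
  rewrite big_nil (_ : (fun y => _) = cst 0); first exact: is_derive_cst.
  by apply/funext => y; rewrite big_nil.
rewrite big_cons (_ : (fun y => _) = fun y =>
  if P i then h i y + \sum_(j <- s | P j) h j y else \sum_(j <- s | P j) h j y).
  by case: ifP => // Pi; apply: is_derive_add => //; exact: H.
by apply/funext => y; rewrite big_cons.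
Qed.

End Pointwise.

(** This passage to one real variable is what makes the mean value theorem applicable. *)
Lemma is_derive_line (V : normedModType R) (f : V -> R) x v (t D : R) :
  is_derive (x + t *: v) v f D <-> is_derive t 1 (fun t' => f (x + t' *: v)) D.
Proof.
rewrite !is_deriveP.
rewrite (_ : (fun h => _) = (fun h => h^-1 * (f (x + (t + h *: 1) *: v) - f (x + t *: v)))).
  by [].
by apply/funext => h; rewrite -addrA -scalerDl [_ *: 1]mulr1.
Qed.
End Calculus.

Lemma nbhs_forall (T : topologicalType) (I : finType) (P : I -> T -> Prop) (x : T) :
  (forall i, nbhs x (P i)) -> nbhs x (fun u => forall i, P i u).
Proof. by move=> H; apply: (@filter_forall T I P (nbhs x) _). Qed.

Lemma nbhs_slice1 {R : realType} {V : normedModType R} (A : set (V * V)) (y1 y2 : V) :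
  nbhs (y1, y2) A -> \forall y \near y1, A (y, y2).
Proof.
move=> /nbhs_ballP[e /= e0 He]; apply/nbhs_ballP; exists e => // y ye.
by apply: He; split=> //; exact: ballxx.
Qed.

Lemma nbhs_slice2 {R : realType} {V : normedModType R} (A : set (V * V)) (y1 y2 : V) :
  nbhs (y1, y2) A -> \forall y \near y2, A (y1, y).
Proof.
move=> /nbhs_ballP[e /= e0 He]; apply/nbhs_ballP; exists e => // y ye.
by apply: He; split=> //; exact: ballxx.
Qed.

Section Calculus1.
Context {R : realType}.

Lemma cvg_sumr (I T : Type) (F : set_system T) {FF : Filter F} (s : seq I)
    (P : pred I) (f : I -> T -> R) (l : I -> R) :
  (forall i, P i -> f i x @[x --> F] --> l i) ->
  \sum_(i <- s | P i) f i x @[x --> F] --> \sum_(i <- s | P i) l i.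
Proof. by apply: cvg_big; exact: add_continuous. Qed.

Lemma mean_value (g dg : R -> R) (a b : R) : a <= b ->
  (forall t : R, a <= t <= b -> is_derive t 1 g (dg t)) ->
  exists2 t, a <= t <= b & g b - g a = dg t * (b - a).
Proof.
move=> ab gD; have [|||t tab e] := @MVT_segment R g dg a b.
- by [].
- by move=> t tab; apply: gD; rewrite !ltW ?(itvP tab).
- by apply: derivable_within_continuous => t tab; have [] := gD t tab.
by exists t.
Qed.

(** Both signs of [h] are covered at once, as difference quotients approach zero from both sides. *)
Lemma mean_value0 (g dg : R -> R) (h : R) :
  (forall t : R, `|t| <= `|h| -> is_derive t 1 g (dg t)) ->
  exists2 t, `|t| <= `|h| & g h - g 0 = dg t * h.
Proof.
move=> gD; have [h0|h0] := leP 0 h.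
  have [|t th e] := @mean_value g dg 0 h h0.
    by move=> t /andP[t0 th]; apply: gD; rewrite !ger0_norm.
  by exists t; [rewrite !ger0_norm//; case/andP: th | rewrite e subr0].
have [|t /andP[ht t0] e] := @mean_value g dg h 0 (ltW h0).
  move=> t /andP[ht t0]; apply: gD; rewrite !ler0_norm// ?lerN2//; exact: ltW.
exists t; last by rewrite -opprB e; ring.
by rewrite !ler0_norm// ?lerN2// ltW.
Qed.

(** No integral is taken: if [P] is the primitive of [c t^p] and [|k| <= 1], then [P - k g] has
    nonnegative derivative; [k = 1] and [k = -1] bound the increment of [g] on both sides. *)
Lemma integrate_power_bound (g dg : R -> R) (c p : R) :
  0 <= c -> 0 <= p -> g 0 = 0 ->
  (forall s : R, 0 <= s <= 1 -> is_derive s 1 g (dg s)) ->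
  (forall s : R, 0 <= s <= 1 -> `|dg s| <= c * s `^ p) ->
  forall s : R, 0 <= s <= 1 -> `|g s| <= c / (p + 1) * s `^ (p + 1).
Proof.
move=> c0 p0 g0 gD gb s /andP[s0 s1].
have p1 : 0 < p + 1 by lra.
move: s0; rewrite le_eqVlt => /orP[/eqP<-|s0].
  by rewrite g0 normr0 powR0 ?mulr0// gt_eqF.
pose P (t : R) := c / (p + 1) * t `^ (p + 1).
have PD (t : R) : 0 < t -> is_derive t 1 P (c * t `^ p).
  move=> t0; have /(is_derive_scale (c / (p + 1))) := @is_derive1_powR R (p + 1) t t0.
  by rewrite addrK mulrA divfK// gt_eqF.
(* The power is differentiated at positive points only, so the comparison starts at [e > 0];
   continuity of [g] at [0] later removes the term [|g e|]. *)
have bound e : 0 < e -> e < s -> `|g s| <= `|g e| + P s.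
  move=> e0 es.
  have incr (k : R) : `|k| <= 1 -> k * (g s - g e) <= P s - P e.
    move=> k1.
    have [||t /andP[et ts] et2] := @mean_value (fun t => P t - k * g t) (fun t => c * t `^ p - k * dg t) e s.
    - exact: ltW.
    - move=> t /andP[et ts]; apply: is_derive_sub; first by apply: PD; lra.
      by apply: is_derive_scale; apply: gD; lra.
    have : 0 <= (c * t `^ p - k * dg t) * (s - e).
      apply: mulr_ge0; last lra.
      rewrite subr_ge0 (le_trans (ler_norm _))// normrM.
      have t01 : 0 <= t <= 1 by lra.
      by rewrite (le_trans _ (gb t t01))// ler_piMl.
    rewrite -et2; lra.
  have Pe : 0 <= P e by rewrite /P mulr_ge0 ?divr_ge0 ?powR_ge0// ltW.
  have h1 : g s - g e <= P s - P e by have := incr 1; rewrite normr1 mul1r; apply.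
  have h2 : g e - g s <= P s - P e by have := incr (-1); rewrite normrN normr1 => /(_ (lexx _)); lra.
  have : `|g s - g e| <= P s by rewrite ler_norml; apply/andP; split; lra.
  have := ler_normD (g s - g e) (g e); rewrite subrK; lra.
apply/ler_addgt0Pr => eps eps0; rewrite -/(P s).
have cg : {for 0, continuous g}.
  apply/differentiable_continuous/derivable1_diffP.
  by have [] := gD 0 _; rewrite ?lexx ?ler01.
move/cvgrPdist_lt: cg => /(_ eps eps0); rewrite g0 => H.
have /(@nbhs_ballP R R) [del /= del0 Hd] := H.
pose e := Num.min (del / 2) (s / 2).
have e0 : 0 < e by rewrite lt_min; apply/andP; split; lra.
have es : e < s by rewrite gt_min; apply/orP; right; lra.
have ed : e < del by rewrite gt_min; apply/orP; left; lra.
have := Hd e; rewrite /ball /= !sub0r !normrN => /(_ _)/=.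
rewrite (gtr0_norm e0) => /(_ ed) he.
have := bound e e0 es; lra.
Qed.

(** [phi m] plays the [m]-th derivative of [phi 0]. The remainder of [phi 1] is the derivative of
    that of [phi 0], so each order costs one integration of a power and contributes one factor
    [gam + j]. *)
Lemma taylor_remainder_bound (gam C : R) (r : nat) (phi : nat -> R -> R) :
  0 < gam -> 0 <= C ->
  (forall m (s : R), (m < r)%N -> 0 <= s <= 1 -> is_derive s 1 (phi m) (phi m.+1 s)) ->
  (forall s : R, 0 <= s <= 1 -> `|phi r s - phi r 0| <= C * s `^ gam) ->
  forall s : R, 0 <= s <= 1 ->
  `|phi 0%N s - \sum_(m < r.+1) phi m 0 * s ^+ m / (m`!)%:R| <=
    C / (\prod_(1 <= j < r.+1) (gam + j%:R)) * s `^ (gam + r%:R).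
Proof.
move=> gam0 C0; elim: r phi => [|r IHr] phi phiD phib s s01.
  rewrite big_ord_recl big_ord0 big_geq// fact0 expr0 mulr1 !divr1 !addr0.
  exact: phib.
have := IHr (phi \o S) (fun m t mr t01 => phiD m.+1 t mr t01) phib.
set P := \prod_(_ <= _ < _) _ => IH.
have P0 : 0 < P by apply: prodr_gt0 => j _; rewrite ltr_wpDr.
pose T (t : R) := \sum_(m < r.+2) phi m 0 * t ^+ m / (m`!)%:R.
have TD (t : R) : is_derive t 1 T (\sum_(m < r.+1) phi m.+1 0 * t ^+ m / (m`!)%:R).
  rewrite (_ : T = fun t => phi 0%N 0 + \sum_(m < r.+1) phi m.+1 0 / (m.+1`!)%:R * t ^+ m.+1); last first.
    apply/funext => u; rewrite /T big_ord_recl expr0 fact0 mulr1 divr1; congr (_ + _).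
    by apply: eq_bigr => m _; rewrite mulrAC.
  rewrite -[\sum_(m < r.+1) _]add0r; apply: is_derive_add.
  apply: is_derive_big => m _.
  have -> : phi m.+1 0 * t ^+ m / m`!%:R = phi m.+1 0 / m.+1`!%:R * (m.+1%:R * t ^+ m).
    have m0 : m.+1%:R != 0 :> R by rewrite pnatr_eq0.
    rewrite factS natrM; move: (phi m.+1 0) (t ^+ m) m`! m.+1%:R m0 => u v n k k0.
    rewrite invfM; move: n%:R^-1 => n1; by field.
  have X : is_derive t 1 (fun y : R => y ^+ m.+1) (m.+1%:R * t ^+ m).
    rewrite (_ : (fun y => _) = (@id R) ^+ m.+1); last by rewrite exprfctE.
    by apply: is_derive_eq; rewrite [LHS]mulr1.
  exact: (@is_derive_scale R R (phi m.+1 0 / m.+1`!%:R) _ _ _ _ X).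
have := @integrate_power_bound (fun t => phi 0%N t - T t)
  (fun t => phi 1%N t - \sum_(m < r.+1) phi m.+1 0 * t ^+ m / (m`!)%:R) (C / P) (gam + r%:R).
move=> /(_ _ _ _ _ _ s s01) h.
have -> : gam + r.+1%:R = gam + r%:R + 1 by rewrite -natr1 addrA.
have -> : C / \prod_(1 <= j < r.+2) (gam + j%:R) = C / P / (gam + r%:R + 1).
  rewrite big_nat_recr//= -/P -natr1 addrA; field.
  by rewrite (gt_eqF P0) /= gt_eqF//; have := ler0n R r; lra.
apply: h.
- by rewrite divr_ge0// ltW.
- by rewrite addr_ge0// ltW.
- rewrite /T big_ord_recl expr0 fact0 mulr1 divr1 big1 => [|m _]; first by rewrite addr0 subrr.
  by rewrite exprS mul0r mulr0 mul0r.
- by move=> t t01; exact: is_derive_sub (phiD 0%N t isT t01) (TD t).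
- by move=> t t01; exact: IH.
Qed.

End Calculus1.

(** * Multi-indices, families of derivatives and polynomials *)

Section MultiIndex.
Context {R : realType} {d : nat}.
Local Notation V := 'rV[R]_d.
Local Notation ve i := (delta_mx ord0 i : V).
Implicit Types (al be : 'I_d -> nat) (f : V -> R) (x y : V).

Definition mi0 : 'I_d -> nat := fun=> 0%N.

Lemma msize_mincr al i : msize (mincr al i) = (msize al).+1.
Proof.
rewrite /msize /mincr big_split /= [X in (_ + X)%N](bigD1 i)//= eqxx.
by rewrite [X in (_ + (_ + X))%N]big1 ?addn0 ?addn1// => j /negbTE ->.
Qed.

Lemma msize_mi0 : msize mi0 = 0%N.
Proof. by rewrite /msize big1. Qed.

Lemma msize_eq0 al : msize al = 0%N -> al = mi0.
Proof.
move=> /eqP; rewrite /msize sum_nat_eq0 => /forallP al0.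
by apply/funext => i; apply/eqP; have := al0 i.
Qed.

Lemma le_msize (al : 'I_d -> nat) i : (al i <= msize al)%N.
Proof. by rewrite /msize (bigD1 i) //= leq_addr. Qed.

Lemma mi_surj r (al : 'I_d -> nat) : (msize al <= r)%N ->
  exists b : {ffun 'I_d -> 'I_r.+1}, mi b = al.
Proof.
move=> alr; exists [ffun i => inord (al i)]; apply/funext => i.
by rewrite /mi ffunE inordK// ltnS (leq_trans (le_msize _ i)).
Qed.

Lemma partial0 f : partial mi0 f = f.
Proof. by rewrite /partial; elim: (enum _). Qed.

(* [partial] is only peeled from the outside, so that the interchange of
   derivatives is never needed for the elements of the native space. *)
Lemma partial_rec m be : msize be = m.+1 ->
  exists al i, [/\ be = mincr al i, msize al = m &
    forall f, partial be f = pderiv i (partial al f)].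
Proof.
move=> be_m.
suff [al [i [e H]]] : exists al i, be = mincr al i /\
    forall f, partial be f = pderiv i (partial al f).
  by exists al, i; split => //; apply: succn_inj; rewrite -be_m e msize_mincr.
have : (0 < \sum_(i <- enum 'I_d) be i)%N by rewrite big_enum /= -/(msize be) be_m.
rewrite /partial; move: (enum_uniq 'I_d); elim: (enum 'I_d) => [|j l IHl].
  by rewrite big_nil.
(* The outermost derivative belongs to the first enumerated coordinate with a nonzero exponent;
   lowering that exponent leaves the rest of the fold unchanged because coordinates do not
   repeat. *)
rewrite /= => /andP[jl ul]; rewrite big_cons; case ej: (be j) => [|n].
  rewrite add0n => /(IHl ul)[al [i [e H]]]; exists al, i; split=> // f.
  have -> : al j = 0%N by move: ej; rewrite e /mincr; case: (al j).
  exact: H.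
move=> _; exists (fun i => be i - (i == j))%N, j; split.
  apply/funext => i; rewrite /mincr subnK//.
  by case: eqP => // ->; rewrite ej.
move=> f; rewrite eqxx ej subn1 /=; congr (pderiv _ (iter _ _ _)).
elim: l jl {ul IHl} => //= k l IHl; rewrite inE negb_or => /andP[jk /IHl ->].
by rewrite eq_sym (negbTE jk) subn0.
Qed.

(** Openness of [A] spreads the equality for lower orders to a neighbourhood, which is what the
    outer derivative sees. *)
Lemma partial_family (g : ('I_d -> nat) -> V -> R) (A : set V) m :
  open A ->
  (forall al i y, (msize al < m)%N -> A y ->
     is_derive y (ve i) (g al) (g (mincr al i) y)) ->
  forall al y, (msize al <= m)%N -> A y -> partial al (g mi0) y = g al y.
Proof.
move=> oA gD al; elim: {al}(msize al) {-2}al (erefl (msize al)) => [|n IHn] al eal y.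
  by rewrite (msize_eq0 eal) partial0.
have [be [i [-> ben ->]]] := partial_rec eal.
rewrite msize_mincr => bem Ay; rewrite /pderiv.
have [_ <-] := gD be i y bem Ay; apply: near_eq_derive.
have : nbhs y A by exact: open_nbhs_nbhs.
by apply: filterS => y' Ay'; apply: IHn => //; exact: ltnW.
Qed.

Lemma partial_local (f g : V -> R) (A : set V) : open A -> (forall y, A y -> f y = g y) ->
  forall al y, A y -> partial al f y = partial al g y.
Proof.
move=> oA fg al; elim: {al}(msize al) {-2}al (erefl (msize al)) => [|n IHn] al eal y Ay.
  by rewrite (msize_eq0 eal) !partial0 fg.
have [be [i [_ ben H]]] := partial_rec eal.
rewrite !H /pderiv; apply: near_eq_derive.
have : nbhs y A by exact: open_nbhs_nbhs.
by apply: filterS => y' Ay'; exact: IHn.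
Qed.

(** A smooth function presented with its derivatives as data. They depend on the multi-index alone,
    so the order of differentiation is never an issue. *)
Definition jet (g : ('I_d -> nat) -> V -> R) : Prop :=
  forall al i y, is_derive y (ve i) (g al) (g (mincr al i) y).

Lemma jet_partial g al : jet g -> partial al (g mi0) = g al.
Proof.
move=> gj; apply/funext => y.
apply: (@partial_family g setT (msize al)) => //; exact: openT.
Qed.

Lemma diffop_jet k (a : {ffun 'I_d -> 'I_k.+1} -> V -> R) g z : jet g ->
  diffop a (g mi0) z = \sum_(al | (msize (mi al) <= k)%N) a al z * g (mi al) z.
Proof. by move=> gj; apply: eq_bigr => al _; rewrite jet_partial. Qed.

Lemma jet_sum (I : finType) (P : pred I) (c : I -> R)
    (g : I -> ('I_d -> nat) -> V -> R) : (forall j, jet (g j)) ->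
  jet (fun al y => \sum_(j | P j) c j * g j al y).
Proof.
move=> gj al i y; apply: is_derive_big => j _.
by apply: is_derive_scale; exact: gj.
Qed.

(** Products of one-variable polynomials, one per coordinate, with their derivatives; monomials and
    powers centred at [z] both have this form. *)
Definition sepoly (q : 'I_d -> {poly R}) al x : R :=
  \prod_(i < d) ((q i)^`(al i)).[x ord0 i].

Lemma sepoly_jet q : jet (sepoly q).
Proof.
move=> al i x.
(* On a line in direction [i] only the factor [i] varies: [p] is this factor recentred at [x], and
   [c] collects the others. *)
pose p : {poly R} := (q i)^`(al i) \Po ('X + (x ord0 i)%:P).
pose c := \prod_(j < d | j != i) ((q j)^`(al j)).[x ord0 j].
have := @is_derive_line R V (sepoly q al) x (ve i) 0 (sepoly q (mincr al i) x).
rewrite scale0r addr0 => /iffRL; apply.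
rewrite (_ : (fun t => _) = (fun t => c * p.[t])); last first.
  apply/funext => t; rewrite /sepoly (bigD1 i) //= mulrC; congr (_ * _).
    by apply: eq_bigr => j ji; rewrite !mxE (negbTE ji) mulr0 addr0.
  by rewrite /p horner_comp !hornerE !mxE !eqxx mulr1 addrC.
have -> : sepoly q (mincr al i) x = c * p^`().[0].
  rewrite /sepoly (bigD1 i) //= mulrC; congr (_ * _).
    by apply: eq_bigr => j ji; rewrite /mincr (negbTE ji) addn0.
  by rewrite /mincr eqxx addn1 derivnS /p deriv_comp derivD derivX derivC addr0 mulr1 horner_comp !hornerE.
by apply: is_derive_scale; exact: is_derive_poly.
Qed.

Lemma monomialE al x : monomial al x = sepoly (fun i => 'X^(al i)) mi0 x.
Proof. by apply: eq_bigr => i _; rewrite derivn0 hornerXn. Qed.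

Lemma polyspaceP q (p : V -> R) : polyspace q p ->
  exists2 g, jet g & p = g mi0.
Proof.
move=> [c pE].
exists (fun al x => \sum_(be : {ffun 'I_d -> 'I_q.+1} | (msize (mi be) < q)%N)
   c be * sepoly (fun i => 'X^(mi be i)) al x).
  by apply: jet_sum => be; exact: sepoly_jet.
by apply/funext => x; rewrite pE; apply: eq_bigr => be _; rewrite monomialE.
Qed.

Lemma polyspace_sum q (I : finType) (P : pred I) (c : I -> R) (p : I -> V -> R) :
  (forall j, P j -> polyspace q (p j)) -> polyspace q (fun x => \sum_(j | P j) c j * p j x).
Proof.
move=> H; have /choice[b bE] : forall j, exists b : {ffun 'I_d -> 'I_q.+1} -> R, P j -> forall x,
     p j x = \sum_(al | (msize (mi al) < q)%N) b al * monomial (mi al) x.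
  by move=> j; case: (boolP (P j)) => [/H[b bE]|_]; [exists b|exists (fun=> 0)].
exists (fun al : {ffun _ -> _} => \sum_(j | P j) c j * b j al) => x.
under [RHS]eq_bigr do rewrite mulr_suml.
rewrite exchange_big /=; apply: eq_bigr => j Pj; rewrite bE// mulr_sumr.
by apply: eq_bigr => al _; rewrite mulrA.
Qed.

Lemma polyspace_monomial q al : (msize al < q)%N -> polyspace q (monomial al : V -> R).
Proof.
move=> alq; have [be beE] := mi_surj (ltnW alq).
exists (fun b : {ffun _ -> _} => (b == be)%:R) => x; rewrite (bigD1 be) /= ?beE//.
rewrite eqxx mul1r big1 ?addr0// => b /andP[_ /negbTE->]; exact: mul0r.
Qed.

Lemma polyspace_le q q' (p : V -> R) : (q <= q')%N -> polyspace q p -> polyspace q' p.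
Proof.
move=> qq' [c /funext ->]; apply: polyspace_sum => al alq.
by apply: polyspace_monomial; exact: leq_trans qq'.
Qed.

Lemma polyspace_sepoly q al (p : 'I_d -> {poly R}) :
  (forall i, (size (p i) <= (al i).+1)%N) -> (msize al < q)%N ->
  polyspace q (sepoly p mi0).
Proof.
move=> sp alq.
suff -> : sepoly p mi0 = (fun x => \sum_(be : {ffun 'I_d -> 'I_q.+1} | (msize (mi be) < q)%N)
    (\prod_i (p i)`_(be i)) * monomial (mi be) x).
  apply: polyspace_sum => be; exact: polyspace_monomial.
apply/funext => x; rewrite /sepoly.
have E i : ((p i)^`(mi0 i)).[x ord0 i] = \sum_(j < q.+1) (p i)`_j * x ord0 i ^+ j.
  rewrite derivn0 (@horner_coef_wide _ q.+1)//; apply: leq_trans (sp i) _.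
  by rewrite ltnS (leq_trans (le_msize _ i))// ltnW.
rewrite (eq_bigr _ (fun i _ => E i)) bigA_distr_bigA /=.
rewrite [RHS]big_mkcond /=; apply: eq_bigr => be _; rewrite big_split /=.
(* A multi-index of size at least [q] exceeds [al] in some coordinate, where the coefficient
   vanishes by the degree bound. *)
case: ifPn => //; rewrite -leqNgt => qbe.
have [i ibe] : exists i, (al i < be i)%N.
  apply/existsP; apply: contraTT qbe => /existsPn H; rewrite -ltnNge.
  apply: leq_ltn_trans alq; apply: leq_sum => i _; have := H i; by rewrite -leqNgt.
by rewrite (bigD1 i) //= nth_default ?mul0r// (leq_trans (sp i)).
Qed.

(** The increment is split into [h u] followed by [h c e_i]. The second step starts at a moving
    point, so it is treated by the mean value theorem and continuity of [Df] at [x]. *)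
Lemma is_derive_comb f (Df : V -> R) x u (i : 'I_d) (A c : R) :
  is_derive x u f A ->
  (\forall y \near x, is_derive y (ve i) f (Df y)) -> {for x, continuous Df} ->
  is_derive x (u + c *: ve i) f (A + c * Df x).
Proof.
move=> /is_deriveP fA fD cD; apply/is_deriveP.
rewrite (_ : (fun h => _) = fun h => h^-1 * (f (x + h *: u) - f x) +
    h^-1 * (f (x + h *: u + (h * c) *: ve i) - f (x + h *: u))); last first.
  by apply/funext => h; rewrite scalerDr scalerA addrA -mulrDr addrC; congr (_ * _); ring.
apply: cvgD => //.
apply/cvgrPdist_le => e e0.
pose e1 := e / (`|c| + 1).
have c1 : 0 < `|c| + 1 by rewrite ltr_wpDl.
have e10 : 0 < e1 by exact: divr_gt0.
have : \forall y \near x, is_derive y (ve i) f (Df y) /\ `|Df x - Df y| <= e1.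
  by apply: filterI => //; move/cvgrPdist_le : cD; apply.
move=> /nbhs_ballP[del /= del0 Hd].
(* [|h| * U] dominates the distance from [x] to every point of the second step. *)
pose U := `|u| + `|c| * `|ve i| + 1.
have U0 : 0 < U by rewrite /U ltr_wpDl// addr_ge0// mulr_ge0.
near=> h.
have h0 : h != 0 by near: h; exact: nbhs_dnbhs_neq.
have hU : `|h| * U < del.
  rewrite -ltr_pdivlMr//; near: h; apply: dnbhs0_lt; exact: divr_gt0.
have inb t : `|t| <= `|h * c| -> ball x del (x + h *: u + t *: ve i).
  move=> th; rewrite -ball_normE /ball_ /= -addrA opprD addrA subrr sub0r normrN.
  apply: le_lt_trans hU; apply: (le_trans (ler_normD _ _)); rewrite !normrZ /U.
  have := ler_wpM2r (normr_ge0 (ve i)) th; rewrite normrM.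
  have := normr_ge0 h; lra.
have [t th tE] := @mean_value0 R (fun t => f (x + h *: u + t *: ve i))
   (fun t => Df (x + h *: u + t *: ve i)) (h * c) (fun t th =>
    (is_derive_line _ _ _ _ _).1 (Hd _ (inb t th)).1).
move: tE; rewrite scale0r addr0 => ->.
have -> : h^-1 * (Df (x + h *: u + t *: ve i) * (h * c)) = c * Df (x + h *: u + t *: ve i) by field.
rewrite -mulrBr normrM (le_trans (ler_wpM2l (normr_ge0 c) (Hd _ (inb t th)).2))//.
rewrite /e1 mulrA ler_pdivrMr// mulrC ler_wpM2l ?ltW//; lra.
Unshelve. all: by end_near. Qed.

(** The direction is assembled one coordinate at a time, starting from zero. *)
Lemma directional_derivative f (Df : 'I_d -> V -> R) x u :
  (forall i, \forall y \near x, is_derive y (ve i) f (Df i y)) ->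
  (forall i, {for x, continuous (Df i)}) ->
  is_derive x u f (\sum_i u ord0 i * Df i x).
Proof.
move=> fD cD; rewrite {1}[u]row_sum_delta.
elim: (index_enum _) => [|i s IHs]; first by rewrite !big_nil; exact: is_derive0.
rewrite !big_cons addrC [X in is_derive _ _ _ X]addrC.
exact: is_derive_comb.
Qed.

End MultiIndex.

(** * Iterated directional derivatives and the multinomial theorem *)

Section Multinomial.
Context {R : realType} {d : nat}.
Local Notation V := 'rV[R]_d.
Implicit Types (u : V).

Lemma monomial_mincr (al : 'I_d -> nat) i u :
  monomial (mincr al i) u = monomial al u * u ord0 i.
Proof.
rewrite /monomial (bigD1 i) //= [in RHS](bigD1 i) //= /mincr eqxx addn1 exprSr.
rewrite mulrAC; congr (_ * _ * _); apply: eq_bigr => j /negbTE ->.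
by rewrite addn0.
Qed.

Lemma monomial_mi0 u : monomial (@mi0 d) u = 1.
Proof. by rewrite /monomial big1. Qed.

Lemma multinom_mincr (al : 'I_d -> nat) i :
  (mincr al i i)%:R / (msize (mincr al i))%:R * multinom (mincr al i) = multinom al :> R.
Proof.
rewrite /multinom msize_mincr factS.
have -> : (\prod_j (mincr al i j)`! = (al i).+1 * \prod_j (al j)`!)%N.
  rewrite (bigD1 i) //= [in RHS](bigD1 i) //= /mincr eqxx addn1 factS mulnA.
  by congr (_ * _)%N; apply: eq_bigr => j /negbTE ->; rewrite addn0.
rewrite /mincr eqxx addn1 !natrM.
have : (msize al).+1%:R != 0 :> R by rewrite pnatr_eq0.
have : (al i).+1%:R != 0 :> R by rewrite pnatr_eq0.
have : (\prod_j (al j)`!)%:R != 0 :> R.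
  by rewrite pnatr_eq0 -lt0n prodn_gt0// => j; exact: fact_gt0.
move: (al i).+1%:R (msize al).+1%:R (msize al)`!%:R (_%:R) => p p1 p2 p3 n3 n1 n2.
by field; rewrite n1 n2 n3.
Qed.

Variable n : nat.
Local Notation mindex := {ffun 'I_d -> 'I_n.+1}.

Lemma mi_le (al : mindex) i : (mi al i <= n)%N.
Proof. by rewrite /mi -ltnS ltn_ord. Qed.

Lemma mi_inj : injective (@mi d n).
Proof.
move=> al be /funeqP e; apply/ffunP => i; apply: val_inj; exact: e.
Qed.

(** The operator [(u . grad)^m] in multi-index form, acting on a family of derivatives [g]. *)
Definition dirsum (m : nat) u (g : ('I_d -> nat) -> R) : R :=
  \sum_(al : mindex | msize (mi al) == m) multinom (mi al) * monomial (mi al) u * g (mi al).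

(** Double counting: for [|al| = m + 1] the fractions [al_i / (m + 1)] add up to one, so each term
    is distributed over the multi-indices obtained by lowering one entry; [multinom_mincr] matches
    the weights. *)
Lemma dirsum_rec m u (g : ('I_d -> nat) -> R) : (m < n)%N ->
  dirsum m u (fun al => \sum_i u ord0 i * g (mincr al i)) = dirsum m.+1 u g.
Proof.
move=> mn; rewrite /dirsum.
under eq_bigr do rewrite mulr_sumr.
rewrite exchange_big /=.
have -> : \sum_(al : mindex | msize (mi al) == m.+1) multinom (mi al) * monomial (mi al) u * g (mi al) =
   \sum_i \sum_(al : mindex | (msize (mi al) == m.+1) && (0 < mi al i)%N)
     (mi al i)%:R / m.+1%:R * (multinom (mi al) * monomial (mi al) u * g (mi al)).
  under [RHS]eq_bigr do rewrite big_mkcondr.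
  rewrite exchange_big; apply: eq_bigr => al /eqP alm.
  rewrite (eq_bigr (fun i => (mi al i)%:R / m.+1%:R * (multinom (mi al) * monomial (mi al) u * g (mi al)))).
    rewrite -mulr_suml -mulr_suml -natr_sum -/(msize _) alm divff ?mul1r// pnatr_eq0//.
  by move=> i _; case: (mi al i) => //=; rewrite !mul0r.
apply: eq_bigr => i _.
(* These maps are inverse to each other as long as [inord] does not truncate; [m < n] leaves room
   for raising an entry. *)
pose inc (al : mindex) : mindex := [ffun j => inord (mincr (mi al) i j)].
pose dec (al : mindex) : mindex := [ffun j => inord (mi al j - (j == i))].
have incE al : (mi al i < n)%N -> mi (inc al) = mincr (mi al) i.
  move=> ali; apply/funext => j; rewrite {1}/mi ffunE inordK// ltnS /mincr.
  by case: eqP => [->|_]; rewrite ?addn1// addn0 mi_le.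
have decE al : (0 < mi al i)%N -> mincr (mi (dec al)) i = mi al.
  move=> ali; apply/funext => j; rewrite /mincr {1}/mi ffunE inordK ?subnK//.
    by case: eqP => // ->.
  by rewrite ltnS (leq_trans (leq_subr _ _)) ?mi_le.
have incdec al : (0 < mi al i)%N -> inc (dec al) = al.
  move=> ali; apply: mi_inj; rewrite incE; first by rewrite decE.
  by have := mi_le al i; rewrite -{1}(decE al ali) /mincr eqxx addn1.
rewrite [RHS](reindex_onto inc dec); last by move=> al /andP[_]; exact: incdec.
apply: eq_big => [al|al /eqP alm].
  apply/eqP/andP => [alm|[/andP[/eqP e p] /eqP al_eq]]; last first.
    by apply: succn_inj; rewrite -(msize_mincr _ i) -al_eq decE.
  have ali : (mi al i < n)%N by rewrite (leq_ltn_trans _ mn)// -alm le_msize.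
  rewrite incE// msize_mincr alm eqxx /mincr eqxx addn1/=; split=> //.
  apply/eqP/mi_inj/funext => j; have : mincr (mi (dec (inc al))) i j = mincr (mi al) i j.
    by rewrite decE incE// /mincr eqxx addn1.
  by rewrite /mincr => /addIn.
have ali : (mi al i < n)%N by rewrite (leq_ltn_trans _ mn)// -alm le_msize.
rewrite incE// monomial_mincr -(multinom_mincr (mi al) i) msize_mincr alm.
by rewrite !mulrA; congr (_ * _); ring.
Qed.

Lemma dirsum0 u g : dirsum 0 u g = g (@mi0 d).
Proof.
rewrite /dirsum (bigD1 [ffun=> ord0]) /=; last first.
  by apply/eqP; rewrite /msize big1// => i _; rewrite /mi ffunE.
have -> : mi ([ffun=> ord0] : mindex) = @mi0 d by apply/funext => i; rewrite /mi ffunE.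
rewrite monomial_mi0 /multinom msize_mi0 big1// divff ?oner_eq0// !mul1r.
rewrite big1 ?addr0// => al /andP[/eqP al0 /eqP]; case.
by apply: mi_inj; rewrite (msize_eq0 al0); apply/funext => i; rewrite /mi ffunE.
Qed.

(** This is [dirsum] of the constant family one. Applied to squared coordinates, it produces powers
    of the Euclidean norm. *)
Lemma multinomial_theorem m u : (m <= n)%N ->
  \sum_(al : mindex | msize (mi al) == m) multinom (mi al) * monomial (mi al) u =
  (\sum_i u ord0 i) ^+ m.
Proof.
move=> mn; transitivity (dirsum m u (fun=> 1)).
  by apply: eq_bigr => al _; rewrite mulr1.
elim: m mn => [|m IHm] mn; first by rewrite dirsum0.
rewrite -dirsum_rec// exprSr -IHm ?(ltnW mn)// /dirsum mulr_suml.
by apply: eq_bigr => al _; rewrite mulr1; congr (_ * _); apply: eq_bigr => i _; rewrite mulr1.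
Qed.

End Multinomial.

(** * Taylor polynomials and functionals exact on polynomials *)

Section Taylor.
Context {R : realType} {d : nat}.
Local Notation V := 'rV[R]_d.
Local Notation ve i := (delta_mx ord0 i : V).

(** A local counterpart of [jet]: differentiability near [S] stops below order [r], and order [r]
    asks only for continuity at points of [S]. *)
Definition smooth_on (r : nat) (S : set V) (g : ('I_d -> nat) -> V -> R) : Prop :=
  forall y, S y -> forall al, (msize al <= r)%N ->
  {for y, continuous (g al)} /\
  ((msize al < r)%N -> forall i, \forall y' \near y,
     is_derive y' (ve i) (g al) (g (mincr al i) y')).

Lemma smooth_on_sum r S (I : finType) (P : pred I) (c : I -> R)
    (g : I -> ('I_d -> nat) -> V -> R) : (forall j, P j -> smooth_on r S (g j)) ->
  smooth_on r S (fun al y => \sum_(j | P j) c j * g j al y).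
Proof.
move=> gS y Sy al alr; split.
  apply: (@cvg_sumr _ _ _ (nbhs y) _) => j Pj.
  by apply: cvgM; [exact: cvg_cst | exact: (gS j Pj y Sy al alr).1].
move=> alr' i.
have : \forall y' \near y, forall j, P j -> is_derive y' (ve i) (g j al) (g j (mincr al i) y').
  apply: (@filter_forall _ _ _ (nbhs y) _) => j; case: (boolP (P j)) => [Pj|_].
    by have := (gS j Pj y Sy al alr).2 alr' i; apply: filterS.
  exact: filterE.
apply: filterS => y' H; apply: is_derive_big => j Pj; apply: is_derive_scale; exact: H.
Qed.

Lemma smooth_on_sub r S (g h : ('I_d -> nat) -> V -> R) :
  smooth_on r S g -> smooth_on r S h -> smooth_on r S (fun al y => g al y - h al y).
Proof.
move=> gS hS y Sy al alr; split.
  exact: cvgB (gS y Sy al alr).1 (hS y Sy al alr).1.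
move=> alr1 i.
apply: filterS2 ((gS y Sy al alr).2 alr1 i) ((hS y Sy al alr).2 alr1 i) => y1.
exact: is_derive_sub.
Qed.

Lemma dirsum_derivative r S g (z u : V) m (s : R) : smooth_on r S g -> (m < r)%N ->
  S (z + s *: u) ->
  is_derive s 1 (fun t => dirsum r m u (fun al => g al (z + t *: u)))
    (dirsum r m.+1 u (fun al => g al (z + s *: u))).
Proof.
move=> gS mr Szs; rewrite -dirsum_rec//; apply: is_derive_big => al /eqP alm.
apply: is_derive_scale.
apply: (@is_derive_line R V (g (mi al)) z u s _).1.
have alr : (msize (mi al) <= r)%N by rewrite alm ltnW.
apply: (@directional_derivative _ _ _ (fun i => g (mincr (mi al) i))) => i.
  by apply: (gS _ Szs _ alr).2; rewrite alm.
by apply: (gS _ Szs _ _).1; rewrite msize_mincr alm.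
Qed.

(** The Taylor polynomial at [z] with derivatives prescribed by [g]; [al] selects one of its own
    derivatives. *)
Definition taylor r (g : ('I_d -> nat) -> R) (z : V) (al : 'I_d -> nat) (y : V) : R :=
  \sum_(be : {ffun 'I_d -> 'I_r.+1} | (msize (mi be) <= r)%N)
    g (mi be) / (\prod_i (mi be i)`!)%:R *
    sepoly (fun i => ('X - (z ord0 i)%:P) ^+ mi be i) al y.

Lemma taylor_jet r g z : jet (taylor r g z).
Proof. by apply: jet_sum => be; exact: sepoly_jet. Qed.

(** Degree at most [r] is order [r + 1], whence this term in the maximum defining [q]. *)
Lemma polyspace_taylor r g z : polyspace r.+1 (taylor r g z (@mi0 d)).
Proof.
apply: polyspace_sum => be ber; apply: (@polyspace_sepoly _ _ _ (mi be)) => // i.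
by rewrite size_exp_XsubC.
Qed.

Lemma derivn_XsubC_exp (c : R) m j : ((('X - c%:P) ^+ m)^`(j)).[c] = (m`!)%:R * (m == j)%:R.
Proof.
have -> : ('X - c%:P) ^+ m = 'X^m \Po ('X - c%:P) :> {poly R} by rewrite comp_Xn_poly.
have -> : ('X^m \Po ('X - c%:P))^`(j) = ('X^m)^`(j) \Po ('X - c%:P) :> {poly R}.
  elim: j ('X^m : {poly R}) => [|j IHj] q; first by rewrite !derivn0.
  by rewrite !derivSn deriv_comp derivB derivX derivC subr0 mulr1 IHj.
rewrite horner_comp !hornerE subrr derivnXn hornerMn hornerXn expr0n subn_eq0.
have [mj|jm|->] := ltngtP m j.
- by rewrite ffact_small// mulr0n mulr0.
- by rewrite mul0rn mulr0.
- by rewrite ffactnn mulr1.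
Qed.

Lemma taylor_center r g z al : (msize al <= r)%N -> taylor r g z al z = g al.
Proof.
move=> alr; have [be beE] := mi_surj alr.
rewrite /taylor (bigD1 be) /= ?beE// [X in _ + X]big1 ?addr0.
  rewrite (_ : sepoly _ al z = (\prod_i (al i)`!)%:R); last first.
    by rewrite natr_prod; apply: eq_bigr => i _; rewrite derivn_XsubC_exp eqxx mulr1.
  by rewrite divfK// pnatr_eq0 -lt0n prodn_gt0// => i; exact: fact_gt0.
move=> b /andP[_ bbe].
have [i ib] : exists i, mi b i != al i.
  apply/existsP; apply: contraNT bbe => /existsPn H; apply/eqP/mi_inj; rewrite beE.
  by apply/funext => i; apply/eqP; have := H i; rewrite negbK.
by rewrite [sepoly _ _ _](bigD1 i)//= derivn_XsubC_exp (negbTE ib) mulr0 mul0r mulr0.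
Qed.

(** Grouping multi-indices by size gives the one-variable Taylor polynomial in direction [u],
    evaluated at parameter one. *)
Lemma taylor_along r g z u :
  taylor r g z (@mi0 d) (z + u) = \sum_(m < r.+1) dirsum r m u g / (m`!)%:R.
Proof.
rewrite /taylor /dirsum.
rewrite (partition_big (fun be : {ffun 'I_d -> 'I_r.+1} => inord (msize (mi be)) : 'I_r.+1) xpredT)//=.
apply: eq_bigr => m _; rewrite mulr_suml; apply: eq_big => [be|be /andP[ber /eqP <-]].
  apply/andP/eqP => [[ber /eqP <-]|bem]; first by rewrite inordK.
  by rewrite bem -ltnS ltn_ord; split=> //; apply/eqP/val_inj; rewrite /= inordK.
rewrite inordK// /multinom.
have -> : sepoly (fun i => ('X - (z ord0 i)%:P) ^+ mi be i) (@mi0 d) (z + u) = monomial (mi be) u.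
  by apply: eq_bigr => i _; rewrite derivn0 horner_exp !hornerE mxE addrAC subrr add0r.
have : (msize (mi be))`!%:R != 0 :> R by rewrite pnatr_eq0 -lt0n fact_gt0.
move: (_`!%:R) (_%:R^-1) => m1 q m0; by field.
Qed.

Lemma star_segment (z : V) N (x : 'I_N -> V) j (s : R) :
  0 <= s <= 1 -> star z x (z + s *: (x j - z)).
Proof.
move=> s01; exists j => //; exists s => //.
by rewrite scalerBr scalerBl scale1r addrA addrAC.
Qed.

(** Since [k <= r], exactness turns the derivatives at [z] into values of the Taylor polynomial at
    the nodes. What is left is one remainder per node, along its segment at [s = 1]. *)
Lemma taylor_functional_bound k (a : {ffun 'I_d -> 'I_k.+1} -> V -> R)
    (z : V) N (x : 'I_N -> V) (w : 'I_N -> R) r (gam : R)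
    (g : ('I_d -> nat) -> V -> R) (B : 'I_N -> R) :
  (k <= r)%N -> 0 < gam ->
  (forall p, polyspace r.+1 p -> \sum_j w j * p (x j) = diffop a p z) ->
  smooth_on r (star z x) g -> (forall j, 0 <= B j) ->
  (forall j (s : R), 0 <= s <= 1 ->
    `|dirsum r r (x j - z) (fun al => g al (z + s *: (x j - z)))
      - dirsum r r (x j - z) (fun al => g al z)| <= B j * s `^ gam) ->
  `|\sum_(al | (msize (mi al) <= k)%N) a al z * g (mi al) z - \sum_j w j * g (@mi0 d) (x j)|
   <= \sum_j `|w j| * B j / \prod_(1 <= j < r.+1) (gam + j%:R).
Proof.
move=> kr gam0 exactw gS B0 gB.
pose T := taylor r (fun al => g al z) z.
have -> : \sum_(al | (msize (mi al) <= k)%N) a al z * g (mi al) z = \sum_j w j * T (@mi0 d) (x j).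
  rewrite exactw; last exact: polyspace_taylor.
  rewrite diffop_jet; last exact: taylor_jet.
  by apply: eq_bigr => al alk; rewrite /T taylor_center// (leq_trans alk).
rewrite -sumrB (le_trans (ler_norm_sum _ _ _))//; apply: ler_sum => j _.
rewrite -mulrBr normrM -mulrA ler_wpM2l//.
pose phi m (s : R) := dirsum r m (x j - z) (fun al => g al (z + s *: (x j - z))).
have := @taylor_remainder_bound R gam (B j) r phi gam0 (B0 j) _ _ 1.
rewrite ler01 lexx powR1 mulr1 => /(_ _ _ isT).
have phi00 : phi 0%N 1 = g (@mi0 d) (x j) by rewrite /phi dirsum0 scale1r addrC subrK.
have -> : \sum_(m < r.+1) phi m 0 * 1 ^+ m / m`!%:R = T (@mi0 d) (x j).
  rewrite -[x j in RHS](subrK z) addrC /T taylor_along; apply: eq_bigr => m _.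
  by rewrite expr1n mulr1 /phi scale0r addr0.
rewrite phi00 distrC; apply.
- by move=> m s mr s01; apply: dirsum_derivative gS mr _; exact: star_segment.
- by move=> s s01; rewrite {2}/phi scale0r addr0; exact: gB.
Qed.

End Taylor.

(** * Functionals dominated by a kernel form, and their limits *)

Section Dominated.
Context {R : realType} {T : Type}.
Implicit Types (F : T -> R) (G : T -> T -> R) (A : set T).

Definition gform (I : finType) (c : I -> R) (t : I -> T) G : R :=
  \sum_i \sum_j c i * c j * G (t i) (t j).

(** The native space inequality with abstract indices: [t] names a functional, [F t] its value, [G]
    the Gram matrix. Arbitrary finite index types make products of index types directly usable. *)
Definition dominated A F G (C : R) : Prop :=
  forall (I : finType) (c : I -> R) (t : I -> T), (forall i, A (t i)) ->
    `|\sum_i c i * F (t i)| <= C * Num.sqrt (gform c t G).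

Lemma cvg_sqrt_mul (X : Type) (E : set_system X) {FE : Filter E} (C l : R) (f : X -> R) :
  f x @[x --> E] --> l -> C * Num.sqrt (f x) @[x --> E] --> C * Num.sqrt l.
Proof.
move=> fl; apply: cvgM; first exact: cvg_cst.
by apply: continuous_cvg => //; exact: sqrt_continuous.
Qed.

(** Gram value of two functionals with two terms each, such as difference quotients, whose steps
    [u.1] and [u.2] vary independently. *)
Definition pairing (c : bool -> R -> R) (p : bool -> R -> T)
    (c' : bool -> R -> R) (p' : bool -> R -> T) G (u : R * R) : R :=
  \sum_b \sum_b' c b u.1 * c' b' u.2 * G (p b u.1) (p' b' u.2).

(** Each index of [B] is approximated by two-term combinations of indices of [A], and both sides of
    the inequality converge as a common step tends to zero. *)
Lemma dominated_limit (A B : set T) F G C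
    (c : T -> bool -> R -> R) (p : T -> bool -> R -> T) :
  (forall t, B t -> \forall h \near 0^', forall b, A (p t b h)) ->
  (forall t t', B t -> B t' ->
     pairing (c t) (p t) (c t') (p t') G (h, h) @[h --> 0^'] --> G t t') ->
  (forall t, B t -> \sum_b c t b h * F (p t b h) @[h --> 0^'] --> F t) ->
  dominated A F G C -> dominated B F G C.
Proof.
move=> pA GB FB domA I a t tB.
have lhs : `|\sum_i a i * \sum_b c (t i) b h * F (p (t i) b h)| @[h --> 0^'] -->
           `|\sum_i a i * F (t i)|.
  apply: cvg_norm; apply: (@cvg_sumr _ _ _ (0^') _) => i _.
  by apply: cvgM; [exact: cvg_cst | exact: FB].
have rhs : C * Num.sqrt (\sum_i \sum_j a i * a j *
      pairing (c (t i)) (p (t i)) (c (t j)) (p (t j)) G (h, h)) @[h --> 0^'] -->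
    C * Num.sqrt (gform a t G).
  apply: cvg_sqrt_mul; apply: (@cvg_sumr _ _ _ (0^') _) => i _.
  apply: (@cvg_sumr _ _ _ (0^') _) => j _.
  by apply: cvgM; [exact: cvg_cst | exact: GB].
apply: (ler_cvg_to lhs rhs).
have : \forall h \near 0^', forall i b, A (p (t i) b h).
  by apply: (@filter_forall _ _ _ (0^') _) => i; exact: pA.
apply: filterS => h ph.
have := domA (I * bool)%type (fun ib => a ib.1 * c (t ib.1) ib.2 h) (fun ib => p (t ib.1) ib.2 h).
move=> /(_ (fun ib => ph _ _)).
rewrite -(pair_bigA _ (fun i b => a i * c (t i) b h * F (p (t i) b h))) /=.
under eq_bigr do under eq_bigr do rewrite -mulrA.
under eq_bigr do rewrite -mulr_sumr.
move/le_trans; apply; rewrite le_eqVlt; apply/orP; left; apply/eqP.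
congr (C * Num.sqrt _); rewrite /gform.
rewrite -(pair_bigA _ (fun i b => \sum_j a i * c (t i) b h *
  (a j.1 * c (t j.1) j.2 h) * G (p (t i) b h) (p (t j.1) j.2 h))) /=.
apply: eq_bigr => i _.
under eq_bigr do rewrite -(pair_bigA _ (fun j b' => a i * c (t i) _ h *
  (a j * c (t j) b' h) * G (p (t i) _ h) (p (t j) b' h))) /=.
rewrite exchange_big /=; apply: eq_bigr => j _; rewrite /pairing mulr_sumr.
apply: eq_bigr => b _; rewrite mulr_sumr; apply: eq_bigr => b' _ /=; ring.
Qed.

(** A Cauchy argument: the combinations for two steps differ by a functional whose form is a signed
    sum of four pairings, tending to [l - l - l + l = 0]. This requires the limit over independent
    steps. *)
Lemma dominated_cvg (A : set T) F G C (c : bool -> R -> R) (p : bool -> R -> T) (l : R) :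
  dominated A F G C ->
  (\forall h \near 0^', forall b, A (p b h)) ->
  pairing c p c p G u @[u --> (0^', 0^')] --> l ->
  cvg (\sum_b c b h * F (p b h) @[h --> 0^']).
Proof.
move=> domA pA Gl.
pose Phi h := \sum_b c b h * F (p b h).
pose q u := pairing c p c p G u.
pose P : set_system (R * R) := filter_prod (0 : R)^' (0 : R)^'.
have FP : Filter P by exact: filter_prod_filter.
have fst0 : u.1 @[u --> P] --> 0^' by exact: cvg_fst.
have snd0 : u.2 @[u --> P] --> 0^' by exact: cvg_snd.
have bound : \forall u \near P, `|Phi u.1 - Phi u.2| <=
    C * Num.sqrt (q (u.1, u.1) - q (u.1, u.2) - q (u.2, u.1) + q (u.2, u.2)).
  have : \forall u \near P, (forall b, A (p b u.1)) /\ (forall b, A (p b u.2)).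
    by apply: (@filterS2 _ P FP _ _ _ _ (fst0 _ pA) (snd0 _ pA)) => u; split.
  apply: filterS => u [A1 A2].
  (* The first boolean selects the step, the second the term; the two steps enter with opposite
     signs. *)
  have := domA (bool * bool)%type (fun b => if b.1 then c b.2 u.1 else - c b.2 u.2)
    (fun b => if b.1 then p b.2 u.1 else p b.2 u.2).
  move=> /(_ _)/le_trans.
  have -> : \sum_(i : bool * bool) (if i.1 then c i.2 u.1 else - c i.2 u.2) *
      F (if i.1 then p i.2 u.1 else p i.2 u.2) = Phi u.1 - Phi u.2.
    rewrite -(pair_bigA _ (fun b b' => (if b then c b' u.1 else - c b' u.2) *
      F (if b then p b' u.1 else p b' u.2))) /= /Phi !big_bool /=; ring.
  apply; first by case=> -[] b /=.
  rewrite le_eqVlt; apply/orP; left; apply/eqP; congr (C * Num.sqrt _); rewrite /gform.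
  rewrite -(pair_bigA _ (fun b b' => \sum_j (if b then c b' u.1 else - c b' u.2) *
     (if j.1 then c j.2 u.1 else - c j.2 u.2) *
     G (if b then p b' u.1 else p b' u.2) (if j.1 then p j.2 u.1 else p j.2 u.2))) /=.
  rewrite !big_bool /=.
  rewrite -!(pair_bigA _ (fun b b' => _ * (if b then c b' u.1 else - c b' u.2) *
     G _ (if b then p b' u.1 else p b' u.2))) /=.
  by rewrite /q /pairing !big_bool /=; ring.
have ql (f g : R * R -> R) : f u @[u --> P] --> 0^' -> g u @[u --> P] --> 0^' ->
    q (f u, g u) @[u --> P] --> l.
  move=> f0 g0; apply: (@cvg_comp _ _ _ (fun u => (f u, g u)) q P P) => //.
  exact: (@cvg_pair _ _ _ P (0 : R)^' (0 : R)^' FP _ _ f g f0 g0).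
have lim0 : C * Num.sqrt (q (u.1, u.1) - q (u.1, u.2) - q (u.2, u.1) + q (u.2, u.2)) @[u --> P] --> 0.
  rewrite -[X in _ --> X](mulr0 C) -(sqrtr0 R); apply: cvg_sqrt_mul.
  have -> : 0 = l - l - l + l :> R by ring.
  by apply: cvgD; [apply: cvgB; [apply: cvgB|]|]; exact: ql.
apply/cauchy_cvgP/cauchy_ballP => e e0.
have : \forall u \near P, ball (Phi u.1) e (Phi u.2).
  move/cvgrPdist_lt : lim0 => /(_ e e0); apply: filterS2 bound => u bu.
  rewrite sub0r normrN => /(le_lt_trans (ler_norm _)); exact: le_lt_trans.
move=> [[U1 U2] [/= H1 H2] H12].
exists (Phi @` U1, Phi @` U2); first split; rewrite /= /nbhs /=.
- by apply: filterS H1 => h U1h; exists h.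
- by apply: filterS H2 => h U2h; exists h.
- move=> [_ _] /= [[h1 U1h1 <-] [h2 U2h2 <-]]; exact: (H12 (h1, h2)).
Qed.

End Dominated.

(** * Existence and domination of derivatives, by induction on the order *)

Section Core.
Context {R : realType} {d : nat}.
Local Notation V := 'rV[R]_d.
Local Notation ve i := (delta_mx ord0 i : V).
Local Notation index := ('I_d -> nat).

Definition diff2 (U : V -> V -> R) (x y u v : V) (h : R * R) : R :=
  h.1^-1 * h.2^-1 * (U (x + h.1 *: u) (y + h.2 *: v) - U (x + h.1 *: u) y
                     - U x (y + h.2 *: v) + U x y).

Variables (W S : set V) (r : nat) (g : index -> index -> V -> V -> R)
  (f : V -> R) (P : index -> V -> R) (C : R).

(* Derivatives of order [r] of the kernel are known to be continuous only at
   points of [S], those of lower order are continuous on the neighbourhood [W]. *)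
Definition level m : set V := if (m < r)%N then W else S.
Definition upto m : set (index * V) := [set t | (msize t.1 <= m)%N /\ level m t.2].

(* An index [(al, y)] stands for the functional mapping [u] to [partial al u y]. *)
Definition gramK (t t' : index * V) : R := g t.1 t'.1 t.2 t'.2.
(** [P] stands for the derivatives of the polynomial that the reduction subtracts from [f]. *)
Definition valF (t : index * V) : R := partial t.1 f t.2 - P t.1 t.2.

Hypothesis oW : open W.
Hypothesis SW : S `<=` W.
Hypothesis gD1 : forall al be i x y, W x -> W y -> (msize al < r)%N -> (msize be <= r)%N ->
  is_derive x (ve i) (fun x' => g al be x' y) (g (mincr al i) be x y).
Hypothesis gD2 : forall al be i x y, W x -> W y -> (msize al <= r)%N -> (msize be < r)%N ->
  is_derive y (ve i) (g al be x) (g al (mincr be i) x y).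
Hypothesis gDD : forall al be i j x y m, msize al = m -> msize be = m -> (m < r)%N ->
  level m.+1 x -> level m.+1 y ->
  diff2 (g al be) x y (ve i) (ve j) h @[h --> (0^', 0^')] --> g (mincr al i) (mincr be j) x y.
Hypothesis PD : jet P.

Lemma level_sub m : level m `<=` W.
Proof. by rewrite /level; case: ifP => _ x //; exact: SW. Qed.

Lemma level_le m n : (m <= n)%N -> level n `<=` level m.
Proof.
move=> mn x nx; rewrite /level; case: ifP => mr; first exact: level_sub nx.
by move: nx; rewrite /level ltnNge (leq_trans _ mn)// leqNgt mr.
Qed.

Definition dq (b : bool) (h : R) : R := if b then h^-1 else - h^-1.
Definition shiftpt (al : index) (i : 'I_d) (y : V) (b : bool) (h : R) : index * V :=
  (al, if b then y + h *: ve i else y).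

Lemma shiftpt_upto m al i y : (m < r)%N -> msize al = m -> W y ->
  \forall h \near (0 : R)^', forall b, upto m (shiftpt al i y b h).
Proof.
move=> mr alm Wy.
have H : \forall h \near (0 : R)^', W (y + h *: ve i).
  apply: nbhs_dnbhs.
  have : (fun h : R => y + h *: ve i) @ (0 : R) --> y + 0 *: ve i.
    by apply: cvgD; [exact: cvg_cst | apply: cvgZr_tmp; exact: cvg_id].
  by apply; apply: open_nbhs_nbhs; rewrite scale0r addr0.
by apply: filterS H => h Wh b; split; [rewrite /= alm | rewrite /level mr; case: b].
Qed.

Lemma pairing_shiftpt al i x be j y :
  pairing dq (shiftpt al i x) dq (shiftpt be j y) gramK =
  diff2 (g al be) x y (ve i) (ve j).
Proof. by apply/funext => h; rewrite /pairing !big_bool /= /gramK /= /diff2; ring. Qed.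

Lemma quotient_cvg m al i y : dominated (upto m) valF gramK C -> (m < r)%N ->
  msize al = m -> level m.+1 y ->
  cvg (h^-1 * (valF (al, y + h *: ve i) - valF (al, y)) @[h --> 0^']).
Proof.
move=> dom mr alm ly.
have Wy := level_sub ly.
have -> : (fun h => h^-1 * (valF (al, y + h *: ve i) - valF (al, y))) =
  fun h => \sum_b dq b h * valF (shiftpt al i y b h).
  by apply/funext => h; rewrite big_bool /=; ring.
apply: (dominated_cvg (l := g (mincr al i) (mincr al i) y y) dom (shiftpt_upto i mr alm Wy)).
by rewrite pairing_shiftpt; exact: (gDD alm alm mr ly ly).
Qed.

Lemma partial_derivable m al i y : dominated (upto m) valF gramK C -> (m < r)%N ->
  msize al = m -> level m.+1 y -> derivable (partial al f) y (ve i).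
Proof.
move=> dom mr alm ly.
have HF : derivable (fun y' => valF (al, y')) y (ve i).
  by apply/derivableE; exact: (quotient_cvg dom mr alm ly).
have {}HF := derivableP HF.
have -> : partial al f = (fun y => valF (al, y) + P al y).
  by apply/funext => y'; rewrite /valF subrK.
by have [] := is_derive_add HF (PD al i y).
Qed.

(** A functional of order [m + 1] is a limit of difference quotients of functionals of order [m],
    along its outermost derivative. *)
Lemma dominated_upto_succ m : dominated (upto m) valF gramK C -> (m < r)%N ->
  dominated (upto m.+1) valF gramK C.
Proof.
move=> dom mr.
have Hdc (be : index) : exists o : option (index * 'I_d),
    if o is Some (al, i) then
      [/\ be = mincr al i, msize al = m & forall u : V -> R, partial be u = pderiv i (partial al u)]
    else (msize be <= m.+1 -> msize be <= m)%N.
  have [e|/eqP e] := eqVneq (msize be) m.+1.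
    have [al [i H]] := @partial_rec R d _ _ e; exists (Some (al, i)). exact: H.
  by exists None; rewrite leq_eqVlt => /orP[/eqP//|].
have [dc dcE] := choice Hdc.
(* Functionals of order at most [m] are kept; coefficients 1 and 0 cast them as two-term
   combinations. *)
pose c (t : index * V) := if dc t.1 is Some _ then dq else fun b => fun=> if b then 1 else 0.
pose p (t : index * V) := if dc t.1 is Some (al, i) then shiftpt al i t.2 else fun _ => fun=> t.
apply: (@dominated_limit R _ (upto m) (upto m.+1) valF gramK C c p) => //.
- move=> [be y] [/= bem ly]; rewrite /p /=; have := dcE be.
  case: (dc be) => [[al i] [_ alm _]|/(_ bem) bem'].
    exact: (shiftpt_upto i mr alm (level_sub ly)).
  by apply: filterE => h b; split => //=; exact: (level_le (leqnSn m) ly).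
- move=> [be x] [be' y] [/= bem lx] [/= bem' ly]; rewrite /c /p /=.
  have Wx := level_sub lx; have Wy := level_sub ly.
  have := dcE be; have := dcE be'.
  (* Two quotients need the mixed derivative on the diagonal, a single quotient an ordinary
     derivative of the kernel; with none the pairing is constant. *)
  case: (dc be') => [[al' j] [e' am' _]|/(_ bem') {}bem'];
    case: (dc be) => [[al i] [e am _]|/(_ bem) {}bem].
  + rewrite pairing_shiftpt.
    have diag : (h, h) @[h --> (0 : R)^'] --> ((0 : R)^', (0 : R)^').
      by apply: cvg_pair; exact: cvg_id.
    rewrite e e' /gramK /=.
    exact: (cvg_comp _ _ diag (gDD am am' mr lx ly)).
  + have /is_deriveP : is_derive y (ve j) (g be al' x) (g be (mincr al' j) x y).
      by apply: gD2 => //; [exact: leq_trans bem (ltnW mr) | rewrite am'].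
    rewrite /gramK /= e'; apply: cvg_trans; apply: near_eq_cvg; apply: filterE => h /=.
    by rewrite /pairing !big_bool /= /gramK /=; ring.
  + have /is_deriveP : is_derive x (ve i) (fun x => g al be' x y) (g (mincr al i) be' x y).
      by apply: gD1 => //; [rewrite am | exact: leq_trans bem' (ltnW mr)].
    rewrite /gramK /= e; apply: cvg_trans; apply: near_eq_cvg; apply: filterE => h /=.
    by rewrite /pairing !big_bool /= /gramK /=; ring.
  + rewrite (_ : (fun h => _) = cst (gramK (be, x) (be', y))); first exact: cvg_cst.
    by apply/funext => h; rewrite /pairing !big_bool /=; ring.
- move=> [be y] [/= bem ly]; rewrite /c /p /=; have := dcE be.
  case: (dc be) => [[al i] [e am pE]|_]; last first.
    rewrite (_ : (fun h => _) = cst (valF (be, y))); first exact: cvg_cst.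
    by apply/funext => h; rewrite big_bool /= mul1r mul0r addr0.
  have /is_deriveP : is_derive y (ve i) (fun y => partial al f y - P al y) (partial be f y - P be y).
    rewrite pE e; apply: is_derive_sub; last exact: PD.
    by apply: derivableP; exact: partial_derivable dom mr am ly.
  rewrite /valF /=; apply: cvg_trans; apply: near_eq_cvg; apply: filterE => h /=.
  by rewrite big_bool /=; ring.
Qed.

Lemma dominated_upto m : dominated (upto 0) valF gramK C -> (m <= r)%N ->
  dominated (upto m) valF gramK C.
Proof.
move=> dom0; elim: m => // m IHm mr.
by apply: dominated_upto_succ => //; apply: IHm; exact: ltnW.
Qed.

(** Orders below [k] are below [r] and hence available on the open set [W]; only the last derivative
    may be confined to [S]. *)
Lemma has_partials_level k y : dominated (upto 0) valF gramK C -> (k <= r)%N ->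
  level k y -> has_partials k f y.
Proof.
move=> dom0; elim: k y => // k IHk y kr ly; split.
  have : nbhs y W by apply: open_nbhs_nbhs; split=> //; exact: level_sub ly.
  by apply: filterS => y' Wy'; apply: IHk; [exact: ltnW | rewrite /level kr].
move=> al alk i; apply: (@partial_derivable k) => //.
by apply: dominated_upto => //; exact: ltnW.
Qed.

End Core.

(** * Mixed second differences of the kernel *)

Section MixedDifferences.
Context {R : realType} {d : nat}.
Local Notation V := 'rV[R]_d.
Local Notation ve i := (delta_mx ord0 i : V).
Implicit Types (U : V -> V -> R) (x y u v : V).

Definition mixed_derivative U x y u v l : Prop :=
  diff2 U x y u v h @[h --> ((0 : R)^', (0 : R)^')] --> (l : R).

Lemma mixed_derivative_sub U U' x y u v l l' :
  mixed_derivative U x y u v l -> mixed_derivative U' x y u v l' ->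
  mixed_derivative (fun x y => U x y - U' x y) x y u v (l - l').
Proof.
move=> Ul Ul'; rewrite /mixed_derivative.
rewrite (_ : diff2 _ x y u v = diff2 U x y u v \- diff2 U' x y u v); first exact: cvgB.
by apply/funext => h; rewrite /diff2 /=; ring.
Qed.

Lemma mixed_derivative_sum (I : finType) (U : I -> V -> V -> R) x y u v (l : I -> R) :
  (forall i, mixed_derivative (U i) x y u v (l i)) ->
  mixed_derivative (fun x y => \sum_i U i x y) x y u v (\sum_i l i).
Proof.
move=> Ul; rewrite /mixed_derivative.
rewrite (_ : diff2 _ _ _ _ _ = fun h => \sum_i diff2 (U i) x y u v h).
  by apply: cvg_sumr => i _; exact: Ul.
by apply/funext => h; rewrite /diff2 -!sumrB -big_split mulr_sumr.
Qed.

Lemma mixed_derivative_mul (A B : V -> R) x y u v a b :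
  is_derive x u A a -> is_derive y v B b ->
  mixed_derivative (fun x y => A x * B y) x y u v (a * b).
Proof.
move=> /is_deriveP Aa /is_deriveP Bb.
rewrite /mixed_derivative.
rewrite (_ : diff2 _ x y u v = (fun h => (h.1^-1 * (A (x + h.1 *: u) - A x)) *
    (h.2^-1 * (B (y + h.2 *: v) - B y)))).
  by apply: cvgM; [exact: cvg_comp cvg_fst Aa | exact: cvg_comp cvg_snd Bb].
by apply/funext => h; rewrite /diff2; ring.
Qed.

Lemma mixed_derivative_mulC (A B : V -> R) x y u v a b :
  is_derive x u A a -> is_derive y v B b ->
  mixed_derivative (fun x y => B y * A x) x y u v (b * a).
Proof.
move=> Aa Bb; rewrite mulrC (_ : (fun x y => _) = (fun x y => A x * B y)).
  exact: mixed_derivative_mul.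
by apply/funext => x'; apply/funext => y'; rewrite mulrC.
Qed.

(** Continuity along the increments [s u] and [t v] only, the ones a mixed difference visits. *)
Definition plane_continuous U x y u v : Prop :=
  forall e, 0 < e -> exists2 del : R, 0 < del & forall s t : R, `|s| < del -> `|t| < del ->
    `|U (x + s *: u) (y + t *: v) - U x y| <= e.

Lemma line_near (A : set V) x u : open A -> A x ->
  exists2 del : R, 0 < del & forall s : R, `|s| < del -> A (x + s *: u).
Proof.
move=> oA Ax; have /nbhs_ballP[e /= e0 He] : nbhs x A by exact: open_nbhs_nbhs.
exists (e / (`|u| + 1)); first by rewrite divr_gt0// ltr_wpDl.
move=> s; rewrite ltr_pdivlMr ?ltr_wpDl// => se; apply: He.
rewrite -ball_normE /ball_ /= opprD addrA subrr sub0r normrN normrZ.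
have := normr_ge0 s; lra.
Qed.

Lemma plane_near (A : set (V * V)) x y u v : nbhs (x, y) A ->
  exists2 del : R, 0 < del & forall s t : R, `|s| < del -> `|t| < del ->
    A (x + s *: u, y + t *: v).
Proof.
move=> /nbhs_ballP[e /= e0 He].
have [||d1 d10 H1] := @line_near (ball x e) x u; [exact: ball_open | exact: ballxx|].
have [||d2 d20 H2] := @line_near (ball y e) y v; [exact: ball_open | exact: ballxx|].
exists (Num.min d1 d2); first by rewrite lt_min d10.
move=> s t; rewrite !lt_min => /andP[s1 _] /andP[_ t2].
by apply: He; split; [exact: H1 | exact: H2].
Qed.

Lemma continuous_plane U x y u v :
  {for (x, y), continuous (fun w : V * V => U w.1 w.2)} -> plane_continuous U x y u v.
Proof.
move=> /cvgrPdist_le cU e e0; have [del del0 H] := plane_near u v (cU e e0).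
by exists del => // s t sd td; rewrite distrC; exact: (H s t).
Qed.

(** Off [S] no continuity is assumed; local bounds on one further derivative in each argument supply
    it through two mean values. *)
Lemma lipschitz_plane (W : set V) U U1 U2 x y u v : open W -> W x -> W y ->
  (forall x y, W x -> W y -> is_derive x u (fun x' => U x' y) (U1 x y)) ->
  (forall x y, W x -> W y -> is_derive y v (U x) (U2 x y)) ->
  (exists M, \forall w \near (x, y), `|U1 w.1 w.2| <= M) ->
  (exists M, \forall w \near (x, y), `|U2 w.1 w.2| <= M) ->
  plane_continuous U x y u v.
Proof.
move=> oW Wx Wy UD1 UD2 [M1 /(plane_near u v)[b1 b10 B1]] [M2 /(plane_near u v)[b2 b20 B2]] e e0.
have [d1 d10 H1] := line_near u oW Wx; have [d2 d20 H2] := line_near v oW Wy.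
pose M := `|M1| + `|M2| + 1.
have M0 : 0 < M by rewrite /M ltr_wpDl// addr_ge0.
exists (Num.min (Num.min (Num.min b1 b2) (Num.min d1 d2)) (e / M)).
  by rewrite !lt_min b10 b20 d10 d20 divr_gt0.
move=> s t; rewrite !lt_min => /andP[/andP[/andP[sb1 _] /andP[sd1 _]] se].
move=> /andP[/andP[/andP[tb1 tb2] /andP[_ td2]] te].
have [s' s's es] := @mean_value0 R (fun s => U (x + s *: u) (y + t *: v))
  (fun s => U1 (x + s *: u) (y + t *: v)) s (fun s' s's =>
   (is_derive_line (fun x' => U x' (y + t *: v)) _ _ _ _).1
     (UD1 _ _ (H1 s' (le_lt_trans s's sd1)) (H2 t td2))).
have [t' t't et] := @mean_value0 R (fun t => U x (y + t *: v))
  (fun t => U2 x (y + t *: v)) t (fun t' t't =>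
   (is_derive_line (U x) _ _ _ _).1 (UD2 _ _ Wx (H2 t' (le_lt_trans t't td2)))).
rewrite scale0r addr0 in es; rewrite scale0r addr0 in et.
have -> : U (x + s *: u) (y + t *: v) - U x y =
   U1 (x + s' *: u) (y + t *: v) * s + U2 x (y + t' *: v) * t by rewrite -es -et; ring.
have h1 := B1 s' t (le_lt_trans s's sb1) tb1.
have := B2 0 t' _ (le_lt_trans t't tb2); rewrite normr0 => /(_ b20) /= h2.
rewrite scale0r addr0 in h2.
rewrite (le_trans (ler_normD _ _))// !normrM.
have h3 : `|U1 (x + s' *: u) (y + t *: v)| * `|s| <= `|M1| * (e / M).
  by apply: ler_pM => //; [exact: le_trans (ler_norm _) | exact: ltW].
have h4 : `|U2 x (y + t' *: v)| * `|t| <= `|M2| * (e / M).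
  by apply: ler_pM => //; [exact: le_trans (ler_norm _) | exact: ltW].
apply: (le_trans (lerD h3 h4)); rewrite -mulrDl mulrCA ger_pMr//.
by rewrite ler_pdivrMr// mul1r /M lerDl.
Qed.

(** One mean value in [x], for the difference in [y], and then one in [y] turn the quotient into a
    value of [U12] at an intermediate point. *)
Lemma mixed_derivative_plane (W : set V) U U1 U12 x y u v : open W -> W x -> W y ->
  (forall x y, W x -> W y -> is_derive x u (fun x' => U x' y) (U1 x y)) ->
  (forall x y, W x -> W y -> is_derive y v (U1 x) (U12 x y)) ->
  plane_continuous U12 x y u v ->
  mixed_derivative U x y u v (U12 x y).
Proof.
move=> oW Wx Wy UD1 UD2 cU; apply/cvgrPdist_le => e e0.
have [d0 d00 H0] := cU e e0.
have [d1 d10 H1] := line_near u oW Wx; have [d2 d20 H2] := line_near v oW Wy.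
pose del := Num.min d0 (Num.min d1 d2).
have del0 : 0 < del by rewrite !lt_min d00 d10 d20.
have N : \forall h \near (0 : R)^', h != 0 /\ `|h| < del.
  by near=> h; split; near: h; [exact: nbhs_dnbhs_neq | exact: dnbhs0_lt].
have : \forall h \near ((0 : R)^', (0 : R)^'), (h.1 != 0 /\ `|h.1| < del) /\ (h.2 != 0 /\ `|h.2| < del).
  by exists ([set h | h != 0 /\ `|h| < del], [set h | h != 0 /\ `|h| < del]).
apply: filterS => -[s t] /= [[s0 sd] [t0 td]].
move: sd td; rewrite !lt_min => /andP[sd0 /andP[sd1 _]] /andP[td0 /andP[_ td2]].
have [s' s's es] := @mean_value0 R (fun s => U (x + s *: u) (y + t *: v) - U (x + s *: u) y)
  (fun s => U1 (x + s *: u) (y + t *: v) - U1 (x + s *: u) y) s (fun s' s's =>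
   is_derive_sub
   ((is_derive_line (fun x' => U x' (y + t *: v)) _ _ _ _).1
     (UD1 _ _ (H1 s' (le_lt_trans s's sd1)) (H2 t td2)))
   ((is_derive_line (fun x' => U x' y) _ _ _ _).1
     (UD1 _ _ (H1 s' (le_lt_trans s's sd1)) Wy))).
have [t' t't et] := @mean_value0 R (fun t => U1 (x + s' *: u) (y + t *: v))
  (fun t => U12 (x + s' *: u) (y + t *: v)) t (fun t' t't =>
   (is_derive_line (U1 (x + s' *: u)) _ _ _ _).1
     (UD2 _ _ (H1 s' (le_lt_trans s's sd1)) (H2 t' (le_lt_trans t't td2)))).
rewrite !scale0r !addr0 in es; rewrite scale0r addr0 in et.
have -> : diff2 U x y u v (s, t) = U12 (x + s' *: u) (y + t' *: v).
  rewrite /diff2 /=.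
  have -> : U (x + s *: u) (y + t *: v) - U (x + s *: u) y - U x (y + t *: v) + U x y =
    U12 (x + s' *: u) (y + t' *: v) * t * s by rewrite -et -es; ring.
  by field; rewrite s0 t0.
by rewrite distrC; apply: H0; [exact: le_lt_trans sd0 | exact: le_lt_trans td0].
Unshelve. all: by end_near. Qed.

(** Finitely many pairs admit a common radius; [W] is the union of the balls of that radius. *)
Lemma open_product_nbhs (J : finType) (sp : J -> V) (P : set (V * V)) :
  (forall p q, nbhs (sp p, sp q) P) ->
  exists2 W : set V, open W & (forall p, W (sp p)) /\ (forall x y, W x -> W y -> P (x, y)).
Proof.
move=> HP.
have : \forall e \near (0 : R)^'+, forall p q, ball (sp p, sp q) e `<=` P.
  apply: filter_forall => p; apply: filter_forall => q.
  have /nbhs_ballP[e /= e0 He] := HP p q.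
  near=> e'; apply: subset_trans He; apply: le_ball; apply: ltW; near: e'.
  exact: nbhs_right_lt.
move=> H; near (0 : R)^'+ => e.
have e0 : 0 < e by [].
have He : forall p q, ball (sp p, sp q) e `<=` P by near: e.
exists (\bigcup_p ball (sp p) e); first by apply: bigcup_open => p _; exact: ball_open.
split=> [p|x y [p _ px] [q _ qy]]; first by exists p => //; exact: ballxx.
by apply: (He p q).
Unshelve. all: by end_near. Qed.

End MixedDifferences.

(** * Reduction of functions and kernels modulo polynomials *)

Section Reduction.
Context {R : realType} {T : Type} {m : nat} (xi : 'I_m -> T) (lam : 'I_m -> T -> R).

(** When the [lam j] reproduce polynomials from their values at the [xi j], this is the remainder of
    a projection and vanishes on polynomials. *)
Definition reduce (h : T -> R) (t : T) : R := h t - \sum_j lam j t * h (xi j).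
Definition reduce2 (G : T -> T -> R) (t t' : T) : R :=
  reduce (fun u => reduce (G u) t') t.

Lemma gformE (I : finType) (c : I -> R) (t : I -> T) (G : T -> T -> R) :
  gform c t G = \sum_i c i * \sum_j c j * G (t i) (t j).
Proof.
by apply: eq_bigr => i _; rewrite mulr_sumr; apply: eq_bigr => j _; rewrite mulrA.
Qed.

Lemma sum_reduce (I : finType) (c : I -> R) (t : I -> T) h :
  \sum_i c i * reduce h (t i) =
  \sum_i c i * h (t i) - \sum_j (\sum_i c i * lam j (t i)) * h (xi j).
Proof.
under [X in _ = _ - X]eq_bigr do rewrite mulr_suml.
rewrite [X in _ = _ - X]exchange_big -sumrB; apply: eq_bigr => i _.
by rewrite /reduce mulrBr mulr_sumr; congr (_ - _); apply: eq_bigr => j _; rewrite mulrA.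
Qed.

(** The hypothesis says that the transpose of [reduce] sends [(c, t)] to [(c', t')]; using it in
    both arguments moves the reduction from the kernel to the functional. *)
Lemma gform_reduce2 (I J : finType) (c : I -> R) (t : I -> T) (c' : J -> R) (t' : J -> T) G :
  (forall h, \sum_i c i * reduce h (t i) = \sum_j c' j * h (t' j)) ->
  gform c t (reduce2 G) = gform c' t' G.
Proof.
move=> H; rewrite !gformE.
have E u : \sum_j c j * reduce (G u) (t j) = \sum_j c' j * G u (t' j) by rewrite H.
rewrite -(H (fun u => \sum_j c' j * G u (t' j))); apply: eq_bigr => i _; congr (_ * _).
rewrite /reduce2 /reduce -/(reduce _ _).
rewrite (_ : \sum_j _ * (_ - _) = \sum_j c j * (reduce (G (t i)) (t j)) -
   \sum_k lam k (t i) * \sum_j c j * reduce (G (xi k)) (t j)).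
  by rewrite E; congr (_ - _); apply: eq_bigr => k _; rewrite E.
under [X in _ = _ - X]eq_bigr do rewrite mulr_sumr.
rewrite [X in _ = _ - X]exchange_big -sumrB; apply: eq_bigr => j _ /=.
rewrite mulrBr mulr_sumr; congr (_ - _); apply: eq_bigr => k _; exact: mulrCA.
Qed.

End Reduction.

Section Reproduction.
Context {R : realType} {T : Type}.

(* The points [xi] are chosen to maximize the rank of the matrix of values. *)
Lemma reproduction (M : nat) (p : 'I_M -> T -> R) (W : set T) :
  exists m (xi : 'I_m -> T) (c : 'I_m -> 'I_M -> R), (forall j, W (xi j)) /\
    forall y, W y -> forall i,
      p i y = \sum_(j < m) (\sum_(l < M) c j l * p l y) * p i (xi j).
Proof.
pose v y : 'rV[R]_M := \row_i p i y.
pose A m (xi : 'I_m -> T) : 'M[R]_(m, M) := \matrix_(j, i) p i (xi j).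
pose Q n := `[< exists m (xi : 'I_m -> T), (forall j, W (xi j)) /\ \rank (A m xi) = n >].
have [||n /asboolP[m [xi [Wxi rA]]] nmax] := @ex_maxnP Q M.
- have xi : 'I_0 -> T by case.
  by exists (\rank (A 0%N xi)); apply/asboolP; exists 0%N, xi; split=> // -[].
- by move=> n /asboolP[m [xi [_ <-]]]; exact: rank_leq_col.
(* The pseudo-inverse does not depend on [y], so the reproducing coefficients are fixed linear
   combinations of the [p l]. *)
exists m, xi, (fun j l => pinvmx (A m xi) l j); split=> // y Wy i.
pose xi' (j : 'I_(m + 1)) := match fintype.split j with inl j => xi j | inr _ => y end.
have rowl j : row (lshift 1 j) (A _ xi') = row j (A m xi).
  by apply/rowP => l; rewrite !mxE /xi' (unsplitK (inl j : 'I_m + 'I_1)).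
have rowr : row (rshift m ord0) (A _ xi') = v y.
  by apply/rowP => l; rewrite !mxE /xi' (unsplitK (inr ord0 : 'I_m + 'I_1)).
have sub : (A m xi <= A _ xi')%MS.
  by apply/row_subP => j; rewrite -rowl; exact: row_sub.
(* Appending [y] cannot raise the maximal rank, so its row of values lies in the row space. *)
have vA : (v y <= A m xi)%MS.
  rewrite -rowr; apply: submx_trans (row_sub _ _) _.
  rewrite -(mxrank_leqif_sup sub) eqn_leq mxrankS//= rA; apply: nmax.
  apply/asboolP; exists (m + 1)%N, xi'; split=> // j.
  by rewrite /xi'; case: (fintype.split j).
have /rowP/(_ i) := mulmxKpV vA; rewrite !mxE => <-.
by apply: eq_bigr => j _; rewrite !mxE; congr (_ * _); apply: eq_bigr => l _; rewrite !mxE mulrC.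
Qed.

End Reproduction.

(** * Native space bound for the error functional *)

Section NativeBound.
Context {R : realType} {d : nat}.
Local Notation V := 'rV[R]_d.
Local Notation ve i := (delta_mx ord0 i : V).
Local Notation index := ('I_d -> nat).
Local Notation o := (@mi0 d).

Lemma native_le_fin s (Om : set V) K f C (I : finType) (y : I -> V) (c : I -> R) :
  native_le s Om K f C -> (forall i, Om (y i)) ->
  (forall p, polyspace s p -> \sum_i c i * p (y i) = 0) ->
  `|\sum_i c i * f (y i)| <= C * Num.sqrt (\sum_i \sum_j c i * c j * K (y i) (y j)).
Proof.
move=> [_ H] Omy cp.
have E (F : I -> R) : \sum_i F i = \sum_(i < #|I|) F (enum_val i).
  by rewrite -big_enum_val.
have := H #|I| (y \o enum_val) (c \o enum_val) (fun i => Omy _).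
rewrite /kform E; under [X in _ -> _ <= _ * Num.sqrt X]eq_bigr do rewrite E.
by rewrite (E (fun i => \sum_(j < #|I|) _)); apply => p /cp; rewrite E.
Qed.

Variables (Om : set V) (K : V -> V -> R) (f : V -> R) (r s : nat) (C : R).
Hypothesis oOm : open Om.
Hypothesis fK : native_le s Om K f C.

Variables (k : nat) (a : {ffun 'I_d -> 'I_k.+1} -> V -> R) (z : V) (N : nat) (x : 'I_N -> V).
Hypothesis kr : (k <= r)%N.

Definition node (j : option 'I_N) : V := if j is Some i then x i else z.
(** The error functional as a finite combination. Multi-indices of size above [k] get coefficient
    zero here and the index [o] in [functional_pt], so that all listed orders stay at most [k]. *)
Definition functional_coef (w : 'I_N -> R) (i : {ffun 'I_d -> 'I_k.+1} + 'I_N) : R :=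
  match i with
  | inl al => if (msize (mi al) <= k)%N then a al z else 0
  | inr j => - w j
  end.
Definition functional_pt (i : {ffun 'I_d -> 'I_k.+1} + 'I_N) : index * V :=
  match i with
  | inl al => (if (msize (mi al) <= k)%N then mi al else o, z)
  | inr j => (o, x j)
  end.

Lemma sum_functional w (h : index * V -> R) :
  \sum_i functional_coef w i * h (functional_pt i) =
  \sum_(al | (msize (mi al) <= k)%N) a al z * h (mi al, z) - \sum_j w j * h (o, x j).
Proof.
rewrite big_sumType /= -sumrN; congr (_ + _).
  rewrite [RHS]big_mkcond; apply: eq_bigr => al _; case: ifP => // _; exact: mul0r.
by apply: eq_bigr => j _; rewrite mulNr.
Qed.

Hypothesis Sx : forall j, Om (node j).
Hypothesis hK : has_continuous_kpartials r (range node) K.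

Local Notation g0 := (fun al be x y => kpartial al be K x y).

(** There are finitely many pairs of nodes and of multi-indices, so the neighbourhoods given by the
    hypothesis combine into one product [W x W]; the local bounds come from continuity at the
    nodes. *)
Lemma kernel_nbhs : exists W : set V, [/\ open W, W `<=` Om, forall j, W (node j) &
  [/\ forall al be i x y, W x -> W y -> (msize al < r)%N -> (msize be <= r)%N ->
       is_derive x (ve i) (fun x' => g0 al be x' y) (g0 (mincr al i) be x y),
     forall al be i x y, W x -> W y -> (msize al <= r)%N -> (msize be < r)%N ->
       is_derive y (ve i) (g0 al be x) (g0 al (mincr be i) x y) &
     forall al be x y, W x -> W y -> (msize al <= r)%N -> (msize be <= r)%N ->
       exists M, \forall u \near (x, y), `|g0 al be u.1 u.2| <= M]].
Proof.
pose P (u : V * V) := Om u.1 /\ forall al be : {ffun 'I_d -> 'I_r.+1},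
  (msize (mi al) <= r)%N -> (msize (mi be) <= r)%N ->
  [/\ (msize (mi al) < r)%N -> forall i,
        is_derive u.1 (ve i) (fun x' => g0 (mi al) (mi be) x' u.2) (g0 (mincr (mi al) i) (mi be) u.1 u.2),
      (msize (mi be) < r)%N -> forall i,
        is_derive u.2 (ve i) (g0 (mi al) (mi be) u.1) (g0 (mi al) (mincr (mi be) i) u.1 u.2) &
      exists M, \forall u' \near u, `|g0 (mi al) (mi be) u'.1 u'.2| <= M].
have [|W oW [Wn WP]] := @open_product_nbhs R d _ node P.
  move=> p q; have [Sp Sq] : range node (node p) /\ range node (node q) by split; eexists.
  apply: filterI.
    exists (Om, setT) => /=; last by move=> ? [].
    by split; [exact: open_nbhs_nbhs | exact: filterT].
  apply: nbhs_forall => al; apply: nbhs_forall => be.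
  case: (boolP (msize (mi al) <= r)%N) => alr; last exact: filterE.
  case: (boolP (msize (mi be) <= r)%N) => ber; last exact: filterE.
  have [cK K1 K2] := hK Sp Sq alr ber.
  have N1 : \forall u \near (node p, node q), (msize (mi al) < r)%N -> forall i,
        is_derive u.1 (ve i) (fun x' => g0 (mi al) (mi be) x' u.2) (g0 (mincr (mi al) i) (mi be) u.1 u.2).
    case: (boolP (msize (mi al) < r)%N) => alr'; last exact: filterE.
    have := nbhs_forall (K1 alr'); apply: filterS => u H _ i; exact: H.
  have N2 : \forall u \near (node p, node q), (msize (mi be) < r)%N -> forall i,
        is_derive u.2 (ve i) (g0 (mi al) (mi be) u.1) (g0 (mi al) (mincr (mi be) i) u.1 u.2).
    case: (boolP (msize (mi be) < r)%N) => ber'; last exact: filterE.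
    have := nbhs_forall (K2 ber'); apply: filterS => u H _ i; exact: H.
  have N3 : \forall u \near (node p, node q), exists M,
      \forall u' \near u, `|g0 (mi al) (mi be) u'.1 u'.2| <= M.
    have : \forall u \near (node p, node q), `|g0 (mi al) (mi be) u.1 u.2| <=
       `|g0 (mi al) (mi be) (node p) (node q)| + 1.
      move/cvgrPdist_le : cK => /(_ 1 ltr01); apply: filterS => u.
      rewrite distrC => H; rewrite -lerBlDl; apply: le_trans H; exact: lerB_dist.
    (* A bound near the pair of nodes is also a bound near each nearby pair. *)
    move=> /near_join; apply: filterS => u H; eexists; exact: H.
  by near=> u => _ _; split; near: u.
exists W; split=> //; first by move=> y Wy; have [] := WP y y Wy Wy.
split.
- move=> al be i y y' Wy Wy' alr ber.
  have [A AE] := mi_surj (ltnW alr); have [B BE] := mi_surj ber.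
  by have [_ /(_ A B)] := WP y y' Wy Wy'; rewrite AE BE => /(_ (ltnW alr) ber)[/(_ alr i)].
- move=> al be i y y' Wy Wy' alr ber.
  have [A AE] := mi_surj alr; have [B BE] := mi_surj (ltnW ber).
  by have [_ /(_ A B)] := WP y y' Wy Wy'; rewrite AE BE => /(_ alr (ltnW ber))[_ /(_ ber i)].
- move=> al be y y' Wy Wy' alr ber.
  have [A AE] := mi_surj alr; have [B BE] := mi_surj ber.
  by have [_ /(_ A B)] := WP y y' Wy Wy'; rewrite AE BE => /(_ alr ber)[].
Unshelve. all: by end_near. Qed.

End NativeBound.

Section NativeBound.
Context {R : realType} {d : nat}.
Local Notation V := 'rV[R]_d.
Local Notation ve i := (delta_mx ord0 i : V).
Local Notation index := ('I_d -> nat).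
Local Notation o := (@mi0 d).

Section ReducedKernel.
Variables (K : V -> V -> R) (r : nat) (W S : set V).
Local Notation g0 := (fun al be x y => kpartial al be K x y).
Hypothesis oW : open W.
Hypothesis SW : S `<=` W.
Hypothesis hK : has_continuous_kpartials r S K.
Hypothesis D1 : forall al be i x y, W x -> W y -> (msize al < r)%N -> (msize be <= r)%N ->
  is_derive x (ve i) (fun x' => g0 al be x' y) (g0 (mincr al i) be x y).
Hypothesis D2 : forall al be i x y, W x -> W y -> (msize al <= r)%N -> (msize be < r)%N ->
  is_derive y (ve i) (g0 al be x) (g0 al (mincr be i) x y).
Hypothesis BD : forall al be x y, W x -> W y -> (msize al <= r)%N -> (msize be <= r)%N ->
  exists M, \forall u \near (x, y), `|g0 al be u.1 u.2| <= M.

(** If [m + 1 < r], derivatives one order higher are bounded and give continuity along the plane; if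
    [m + 1 = r], both points lie in [S], where continuity is assumed. *)
Lemma kernel_mixed_derivative al be i j x y m :
  msize al = m -> msize be = m -> (m < r)%N ->
  level W S r m.+1 x -> level W S r m.+1 y ->
  mixed_derivative (g0 al be) x y (ve i) (ve j) (g0 (mincr al i) (mincr be j) x y).
Proof.
move=> am bm mr lx ly.
have Wx := level_sub SW lx; have Wy := level_sub SW ly.
apply: (@mixed_derivative_plane _ _ W _ (g0 (mincr al i) be)) => //.
- by move=> x' y' Wx' Wy'; apply: D1 => //; rewrite ?am ?bm// ltnW.
- by move=> x' y' Wx' Wy'; apply: D2 => //; rewrite ?msize_mincr ?am ?bm.
move: lx ly; rewrite /level; case: ifPn => [mr1 _ _|_ Sx Sy].
  apply: (@lipschitz_plane _ _ W _ (g0 (mincr (mincr al i) i) (mincr be j))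
     (g0 (mincr al i) (mincr (mincr be j) j))) => //.
  + by move=> x' y' Wx' Wy'; apply: D1 => //; rewrite ?msize_mincr ?am ?bm.
  + by move=> x' y' Wx' Wy'; apply: D2 => //; rewrite ?msize_mincr ?am ?bm.
  + by apply: BD => //; rewrite ?msize_mincr ?am ?bm.
  + by apply: BD => //; rewrite ?msize_mincr ?am ?bm.
apply: continuous_plane.
by have [] := hK Sx Sy (al := mincr al i) (be := mincr be j) _ _; rewrite ?msize_mincr ?am ?bm.
Qed.

Variables (m : nat) (xi : 'I_m -> V) (l : 'I_m -> index -> V -> R).
Hypothesis Wxi : forall j, W (xi j).
Hypothesis lj : forall j, jet (l j).

(** In the correction terms the derivatives fall on the smooth coefficients [l j], while the
    evaluation points [xi j] keep the index [o]. *)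
Definition reduced_kernel (al be : index) (x y : V) : R :=
  reduce2 (fun j => (o, xi j)) (fun j t => l j t.1 t.2) (gramK g0) (al, x) (be, y).

Lemma reduced_kernel_derive1 al be i x y : W x -> W y -> (msize al < r)%N -> (msize be <= r)%N ->
  is_derive x (ve i) (fun x' => reduced_kernel al be x' y) (reduced_kernel (mincr al i) be x y).
Proof.
move=> Wx Wy alr ber; apply: is_derive_sub.
  apply: is_derive_sub; first exact: D1.
  apply: is_derive_big => j _; apply: is_derive_scale.
  by apply: D1 => //=; rewrite msize_mi0.
by apply: is_derive_big => j _; apply: is_derive_scaler; exact: lj.
Qed.

Lemma reduced_kernel_derive2 al be i x y : W x -> W y -> (msize al <= r)%N -> (msize be < r)%N ->
  is_derive y (ve i) (reduced_kernel al be x) (reduced_kernel al (mincr be i) x y).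
Proof.
move=> Wx Wy alr ber; apply: is_derive_sub.
  apply: is_derive_sub; first exact: D2.
  by apply: is_derive_big => j _; apply: is_derive_scaler; exact: lj.
apply: is_derive_big => j _; apply: is_derive_scale.
apply: is_derive_sub; first by apply: D2 => //=; rewrite msize_mi0.
by apply: is_derive_big => j' _; apply: is_derive_scaler; exact: lj.
Qed.

Lemma reduced_kernel_mixed_derivative al be i j x y n :
  msize al = n -> msize be = n -> (n < r)%N ->
  level W S r n.+1 x -> level W S r n.+1 y ->
  mixed_derivative (reduced_kernel al be) x y (ve i) (ve j)
    (reduced_kernel (mincr al i) (mincr be j) x y).
Proof.
move=> am bm mr lx ly.
have Wx := level_sub SW lx; have Wy := level_sub SW ly.
have r0 : (msize o <= r)%N by rewrite msize_mi0.
apply: mixed_derivative_sub.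
  apply: mixed_derivative_sub; first exact: kernel_mixed_derivative am bm mr lx ly.
  apply: mixed_derivative_sum => j'; apply: mixed_derivative_mulC; last exact: lj.
  by apply: D1 => //=; rewrite am.
apply: mixed_derivative_sum => k'; apply: mixed_derivative_mul; first exact: lj.
apply: is_derive_sub; first by apply: D2 => //=; rewrite bm.
by apply: is_derive_big => j' _; apply: is_derive_scaler; exact: lj.
Qed.

End ReducedKernel.

(** The reduction makes the native space inequality available at every stage of the passage to
    derivatives. The error functional annihilates polynomials of order [s] by itself, so it does not
    see the reduction in the end. *)
Lemma native_bound (Om : set V) (K : V -> V -> R) (f : V -> R) (r s : nat) (C : R)
    (k : nat) (a : {ffun 'I_d -> 'I_k.+1} -> V -> R) (z : V) (N : nat) (x : 'I_N -> V)
    (w : 'I_N -> R) (M : nat) (p : 'I_M -> V -> R) :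
  open Om -> native_le s Om K f C -> (k <= r)%N -> (forall j, Om (node z x j)) ->
  has_continuous_kpartials r (range (node z x)) K -> polybasis s p ->
  (forall q, polyspace s q -> \sum_j w j * q (x j) = diffop a q z) ->
  has_partials k f z /\
  `|diffop a f z - \sum_j w j * f (x j)| <=
    C * Num.sqrt (gform (functional_coef a z w) (@functional_pt R d k z N x)
                  (gramK (fun al be x y => kpartial al be K x y))).
Proof.
move=> oOm fK kr Omn hK [pP pspan _] wex.
have [W [oW WOm Wn [D1 D2 BD]]] := kernel_nbhs oOm Omn hK.
have SW : range (node z x) `<=` W by move=> _ [j _ <-].
have [m [xi [c [Wxi rep]]]] := reproduction p W.
have lpoly j : polyspace s (fun y => \sum_(i < M) c j i * p i y).
  by apply: polyspace_sum => i _; exact: pP.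
have Hl j : exists l : index -> V -> R, jet l /\ l o = (fun y => \sum_(i < M) c j i * p i y).
  by have [l lj le] := polyspaceP (lpoly j); exists l.
have [l lE] := choice Hl.
have lj j : jet (l j) by have [] := lE j.
have lo j : l j o = (fun y => \sum_(i < M) c j i * p i y) by have [] := lE j.
pose lam (j : 'I_m) (t : index * V) : R := l j t.1 t.2.
pose xi' (j : 'I_m) : index * V := (o, xi j).
pose P al y := \sum_j f (xi j) * l j al y.
have PD : jet P by exact: jet_sum.
pose g0 al be x y := kpartial al be K x y.
pose Kt := reduced_kernel K xi l.
have g00 y y' : g0 o o y y' = K y y' by rewrite /g0 /kpartial !partial0.
have poly0 q y : polyspace s q -> W y -> reduce xi' lam (fun t => q t.2) (o, y) = 0.
  move=> /pspan[b bE] Wy; rewrite /reduce /lam /= bE.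
  under [X in _ - X]eq_bigr do rewrite bE mulr_sumr.
  rewrite exchange_big -sumrB big1// => i _ /=.
  rewrite (rep y Wy i) mulr_sumr -sumrB big1// => j _.
  by rewrite lo; ring.
(* At order zero this is the original inequality for the given points together with the [xi j],
   whose coefficients make the combination annihilate polynomials. *)
have dom0 : dominated (upto W (range (node z x)) r 0) (valF f P) (gramK Kt) C.
  move=> I b t tU.
  have [y [te Wy]] : exists y : I -> V, (forall i, t i = (o, y i)) /\ (forall i, W (y i)).
    exists (fun i => (t i).2); split=> i; have [t0 tl] := tU i.
      move: t0; rewrite leqn0 => /eqP/msize_eq0; by case: (t i) => al y /= ->.
    exact: level_sub tl.
  pose b' (i : I + 'I_m) := match i with inl i => b i | inr j => - \sum_i b i * lam j (t i) end.
  pose y' (i : I + 'I_m) := match i with inl i => y i | inr j => xi j end.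
  have sumE h : \sum_i b i * reduce xi' lam h (t i) = \sum_i b' i * h (o, y' i).
    rewrite sum_reduce big_sumType /= -sumrN; congr (_ + _).
      by apply: eq_bigr => i _; rewrite te.
    by apply: eq_bigr => j _; rewrite mulNr.
  have := @native_le_fin R d s Om K f C (I + 'I_m)%type y' b' fK.
  have -> : \sum_i b i * valF f P (t i) = \sum_i b' i * f (y' i).
    rewrite -(sumE (fun t => f t.2)); apply: eq_bigr => i _; congr (_ * _).
    rewrite te /valF /reduce /lam /= partial0; congr (_ - _).
    by apply: eq_bigr => j _; rewrite mulrC.
  have -> : gform b t (gramK Kt) = \sum_i \sum_j b' i * b' j * K (y' i) (y' j).
    have -> : gform b t (gramK Kt) = gform b t (reduce2 xi' lam (gramK g0)) by [].
    rewrite (@gform_reduce2 _ _ _ _ _ _ _ b t b' (fun i => (o, y' i)) _ sumE).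
    by apply: eq_bigr => i _; apply: eq_bigr => j _; rewrite /gramK /= g00.
  apply; first by case=> [i|j] /=; exact: WOm.
  move=> q qs; rewrite -(sumE (fun t => q t.2)) big1// => i _.
  by rewrite te poly0// mulr0.
have gD1 := reduced_kernel_derive1 D1 Wxi lj.
have gD2 := reduced_kernel_derive2 D2 Wxi lj.
have gDD := reduced_kernel_mixed_derivative oW SW hK D1 D2 BD Wxi lj.
have nodeS j : range (node z x) (node z x j) by exists j.
split.
  apply: (has_partials_level oW SW gD1 gD2 gDD PD dom0 kr).
  by rewrite /level; case: ifP => _; [exact: (Wn None) | exact: (nodeS None)].
have dom := dominated_upto oW SW gD1 gD2 gDD PD dom0 (leqnn r).
have := dom _ (functional_coef a z w) (@functional_pt R d k z N x).
have exact_jet q : polyspace s (q o) -> jet q ->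
    \sum_(al | (msize (mi al) <= k)%N) a al z * q (mi al) z - \sum_j w j * q o (x j) = 0.
  by move=> qs qj; rewrite (wex _ qs) diffop_jet// subrr.
(* Each [lam j] is a polynomial of order [s] on which [w] is exact, so all correction terms drop
   out. *)
have -> : gform (functional_coef a z w) (@functional_pt R d k z N x) (gramK Kt) =
    gform (functional_coef a z w) (@functional_pt R d k z N x) (gramK g0).
  apply: (@gform_reduce2 _ _ _ xi' lam) => h.
  rewrite sum_reduce [X in _ - X]big1 ?subr0// => j _.
  rewrite (sum_functional a z x w (lam j)) /lam /= exact_jet ?mul0r//.
  by rewrite lo.
rewrite (sum_functional a z x w (valF f P)).
have -> : \sum_(al | (msize (mi al) <= k)%N) a al z * valF f P (mi al, z) -
    \sum_j w j * valF f P (o, x j) = diffop a f z - \sum_j w j * f (x j).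
  have /exact_jet/(_ PD)/eqP : polyspace s (P o).
    by apply: polyspace_sum => j _; rewrite lo.
  rewrite subr_eq0 => /eqP E; rewrite /valF /diffop /= partial0.
  under eq_bigr do rewrite mulrBr.
  under [X in _ - X = _]eq_bigr do rewrite mulrBr.
  by rewrite !sumrB E; ring.
apply=> -[al|j]; split; rewrite /= /level ?ltnn.
- by case: ifPn => [alk|_]; [exact: leq_trans kr | rewrite msize_mi0].
- exact: (nodeS None).
- by rewrite msize_mi0.
- exact: (nodeS (Some j)).
Qed.

End NativeBound.

(** * Optimality of the kernel-based weights *)

Section Optimality.
Context {R : realType} {d : nat}.
Local Notation V := 'rV[R]_d.
Local Notation index := ('I_d -> nat).
Local Notation o := (@mi0 d).
Local Notation g0 K := (fun al be x y => kpartial al be K x y).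

Lemma kpartial_sym (Om : set V) (K : V -> V -> R) al x y : open Om ->
  symmetric_on Om K -> Om x -> Om y -> kpartial o al K x y = kpartial al o K y x.
Proof.
move=> oOm Ksym Omx Omy; rewrite /kpartial partial0.
by apply: partial_local oOm _ _ _ Omy => y' Omy'; rewrite partial0 Ksym.
Qed.

(** By the kernel equations, the error functional maps [K(., x_j)] to the value at [x_j] of the
    polynomial [sum_l v_l p_l]. The difference [u] of two exact weights annihilates it, so the cross
    terms of the form vanish. *)
Lemma kernel_weights_optimal (Om : set V) (K : V -> V -> R) (s : nat)
    (k : nat) (a : {ffun 'I_d -> 'I_k.+1} -> V -> R) (z : V) (N : nat) (x : 'I_N -> V)
    (M : nat) (p : 'I_M -> V -> R) (w w' : 'I_N -> R) :
  open Om -> symmetric_on Om K -> cond_posdef s Om K -> injective x ->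
  (forall j, Om (node z x j)) -> polybasis s p -> kernel_weights a K z x p w ->
  (forall q, polyspace s q -> \sum_j w j * q (x j) = diffop a q z) ->
  (forall q, polyspace s q -> \sum_j w' j * q (x j) = diffop a q z) ->
  gform (functional_coef a z w) (functional_pt z x) (gramK (g0 K)) <=
  gform (functional_coef a z w') (functional_pt z x) (gramK (g0 K)).
Proof.
move=> oOm Ksym Kpd xinj Omn [pP _ _] [v [vE _]] wex wex'.
pose u j := w' j - w j.
pose G := gramK (g0 K).
pose E h := \sum_i functional_coef a z w i * h (functional_pt z x i).
have uq q : polyspace s q -> \sum_j u j * q (x j) = 0.
  move=> qs; under eq_bigr do rewrite mulrBl.
  by rewrite sumrB wex ?wex'// subrr.
have E' h : \sum_i functional_coef a z w' i * h (functional_pt z x i) =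
    E h - \sum_j u j * h (o, x j).
  rewrite /E !sum_functional -addrA -opprD -big_split /=; congr (_ - _).
  by apply: eq_bigr => j _; rewrite /u; ring.
have Ksx i j : K (x i) (x j) = K (x j) (x i).
  by apply: Ksym; [exact: (Omn (Some i)) | exact: (Omn (Some j))].
have cross1 j : E (G^~ (o, x j)) = \sum_l v l * p l (x j).
  rewrite /E (sum_functional a z x w (G^~ (o, x j))) /G /gramK /=.
  apply/eqP; rewrite subr_eq addrC; apply/eqP.
  have -> : \sum_(al | (msize (mi al) <= k)%N) a al z * kpartial (mi al) o K z (x j) =
      diffop a (fun u => K u (x j)) z.
    apply: eq_bigr => al _; congr (_ * partial _ _ _); apply/funext => y.
    by rewrite partial0.
  rewrite -vE; congr (_ + _); apply: eq_bigr => i _.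
  by rewrite /kpartial !partial0 Ksx.
have cross2 j : E (G (o, x j)) = \sum_l v l * p l (x j).
  rewrite -cross1; apply: eq_bigr => i _; congr (_ * _).
  case: i => [al|i]; rewrite /G /gramK /=.
    by apply: (kpartial_sym _ oOm Ksym (Omn (Some j)) (Omn None)).
  by rewrite /kpartial !partial0 Ksx.
have crossu : \sum_j u j * (\sum_l v l * p l (x j)) = 0.
  under eq_bigr do rewrite mulr_sumr.
  rewrite exchange_big big1// => l _.
  under eq_bigr do rewrite mulrCA.
  by rewrite -mulr_sumr uq// mulr0.
have EB h h' : E (fun t => h t - h' t) = E h - E h'.
  by rewrite /E -sumrB; apply: eq_bigr => i _; rewrite mulrBr.
have Esum (h : 'I_N -> index * V -> R) (c : 'I_N -> R) :
    E (fun t => \sum_j c j * h j t) = \sum_j c j * E (h j).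
  rewrite /E; under eq_bigr do rewrite mulr_sumr.
  rewrite exchange_big; apply: eq_bigr => j _; rewrite mulr_sumr.
  by apply: eq_bigr => i _; rewrite mulrCA.
have -> : gform (functional_coef a z w') (functional_pt z x) G =
    gform (functional_coef a z w) (functional_pt z x) G + kform K u x.
  rewrite !gformE.
  under eq_bigr do rewrite (E' (G _)).
  rewrite (E' (fun t => E (G t) - \sum_j u j * G t (o, x j))).
  rewrite EB (Esum (fun j t => G t (o, x j))).
  under eq_bigr do rewrite cross1.
  rewrite crossu subr0 /=.
  under [X in _ - X]eq_bigr do rewrite cross2 mulrBr.
  rewrite sumrB crossu sub0r opprK; congr (_ + _).
  apply: eq_bigr => i _; rewrite mulr_sumr; apply: eq_bigr => j _.
  by rewrite mulrA /G /gramK /= /kpartial !partial0.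
(* Positivity is given for nonzero coefficients only, so [u = 0] is treated separately. *)
rewrite lerDl; have [/existsP[i ui]|/existsPn u0] := boolP [exists i, u i != 0].
  apply: ltW; apply: Kpd => //; last by exists i.
  by move=> j; exact: (Omn (Some j)).
rewrite /kform big1// => i _; rewrite big1// => j _.
by have := u0 i; rewrite negbK => /eqP ->; rewrite !mul0r.
Qed.

End Optimality.

(** * Taylor expansion in both arguments of the kernel *)

Section DoubleTaylor.
Context {R : realType} {d : nat}.
Local Notation V := 'rV[R]_d.
Local Notation index := ('I_d -> nat).
Local Notation o := (@mi0 d).
Local Notation g0 K := (fun al be x y => kpartial al be K x y).

(** A weighted sum of squares gives a nonnegative quadratic form. It is evaluated at [(B, -S)] or
    [(-S, A)]; if [A] and [B] both vanish, [(1, 1)] and [(1, -1)] force [S = 0]. *)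
Lemma weighted_cauchy_schwarz (I : finType) (P : pred I) (W x y : I -> R) :
  (forall i, P i -> 0 <= W i) ->
  (\sum_(i | P i) W i * (x i * y i)) ^+ 2 <=
  (\sum_(i | P i) W i * x i ^+ 2) * (\sum_(i | P i) W i * y i ^+ 2).
Proof.
move=> W0; set S := \sum_(i | P i) _; set A := \sum_(i | P i) _ * x _ ^+ 2.
set B := \sum_(i | P i) _.
have quad (al be : R) : 0 <= al ^+ 2 * A + 2 * al * be * S + be ^+ 2 * B.
  have -> : al ^+ 2 * A + 2 * al * be * S + be ^+ 2 * B =
    \sum_(i | P i) W i * (al * x i + be * y i) ^+ 2.
    rewrite /A /S /B !mulr_sumr -!big_split; apply: eq_bigr => i _ /=; ring.
  by apply: sumr_ge0 => i Pi; rewrite mulr_ge0 ?sqr_ge0 ?W0.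
have A0 : 0 <= A by have := quad 1 0; rewrite expr1n expr0n !mulr0 !mul0r !addr0 mul1r.
have B0 : 0 <= B by have := quad 0 1; rewrite expr1n expr0n !mulr0 !mul0r !add0r mul1r.
have [Bpos|] := ltP 0 B.
  have := quad B (- S); have -> : B ^+ 2 * A + 2 * B * - S * S + (- S) ^+ 2 * B =
    B * (A * B - S ^+ 2) by ring.
  by rewrite pmulr_rge0// subr_ge0.
move=> B0'; have {B0 B0'}Beq : B = 0 by apply/eqP; rewrite eq_le B0' B0.
rewrite Beq mulr0; have [Apos|] := ltP 0 A.
  have := quad (- S) A; have -> : (- S) ^+ 2 * A + 2 * - S * A * S + A ^+ 2 * B =
    A * (A * B - S ^+ 2) by ring.
  by rewrite pmulr_rge0// subr_ge0 Beq mulr0.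
move=> A0'; have {A0 A0'}Aeq : A = 0 by apply/eqP; rewrite eq_le A0' A0.
have h1 := quad 1 1; have h2 := quad 1 (-1).
have -> : S = 0 by rewrite Aeq Beq in h1 h2; lra.
by rewrite expr0n.
Qed.

Lemma dirsum_sum (n m : nat) (u : V) (I : finType) (c : I -> R) (g : I -> index -> R) :
  dirsum n m u (fun al => \sum_i c i * g i al) = \sum_i c i * dirsum n m u (g i).
Proof.
rewrite /dirsum; under eq_bigr do rewrite mulr_sumr.
rewrite exchange_big; apply: eq_bigr => i _; rewrite mulr_sumr.
by apply: eq_bigr => al _; rewrite mulrCA.
Qed.

Lemma dirsum_sub (n m : nat) (u : V) (g h : index -> R) :
  dirsum n m u (fun al => g al - h al) = dirsum n m u g - dirsum n m u h.
Proof. by rewrite /dirsum -sumrB; apply: eq_bigr => al _; rewrite mulrBr. Qed.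

Variables (K : V -> V -> R) (r : nat) (z : V) (N : nat) (x : 'I_N -> V).
Local Notation S := (star z x).
Hypothesis hK : has_continuous_kpartials r S K.

Lemma kernel_smooth_on1 be y : S y -> (msize be <= r)%N ->
  smooth_on r S (fun al x' => kpartial al be K x' y).
Proof.
move=> Sy ber x' Sx' al alr; have [/cvgrPdist_le cK K1 _] := hK Sx' Sy alr ber; split.
  by apply/(@cvgrPdist_le _ _ _ (nbhs x') _) => e e0; exact: nbhs_slice1 (cK e e0).
by move=> alr' i; exact: nbhs_slice1 (K1 alr' i).
Qed.

Lemma kernel_smooth_on2 al x' : S x' -> (msize al <= r)%N ->
  smooth_on r S (fun be y => kpartial al be K x' y).
Proof.
move=> Sx' alr y Sy be ber; have [/cvgrPdist_le cK _ K2] := hK Sx' Sy alr ber; split.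
  by apply/(@cvgrPdist_le _ _ _ (nbhs y) _) => e e0; exact: nbhs_slice2 (cK e e0).
by move=> ber' i; exact: nbhs_slice2 (K2 ber' i).
Qed.

Definition kernel_diff (al be : index) (x' y : V) : R :=
  kpartial al be K x' y - kpartial al be K x' z - kpartial al be K z y + kpartial al be K z z.

(** [taylor_functional_bound] is used twice. In the second argument it is applied to increments of
    the [r]-th directional derivative in the first; the result is the Hoelder constant for its use
    in the first argument. Each use contributes one factor [T / P]. *)
Lemma gform_taylor_bound (k : nat) (a : {ffun 'I_d -> 'I_k.+1} -> V -> R) (w : 'I_N -> R)
    (gam Q : R) (n : 'I_N -> R) : (0 < N)%N ->
  (k <= r)%N -> 0 < gam -> 0 <= Q -> (forall j, 0 <= n j) ->
  (forall q, polyspace r.+1 q -> \sum_j w j * q (x j) = diffop a q z) ->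
  (forall i j (s t : R), 0 <= s <= 1 -> 0 <= t <= 1 ->
    `|dirsum r r (x i - z) (fun al => dirsum r r (x j - z) (fun be =>
       kernel_diff al be (z + s *: (x i - z)) (z + t *: (x j - z))))| <=
    Q * (n i * s `^ gam) * (n j * t `^ gam)) ->
  gform (functional_coef a z w) (functional_pt z x) (gramK (g0 K)) <=
    Q / (\prod_(1 <= j < r.+1) (gam + j%:R)) ^+ 2 * (\sum_j `|w j| * n j) ^+ 2.
Proof.
move=> N0 kr gam0 Q0 n0 wex H.
set P := \prod_(_ <= _ < _) _.
have P0 : 0 < P by apply: prodr_gt0 => j _; rewrite ltr_wpDr.
set T := \sum_j _.
have seg := @star_segment R d z N x.
have Sz : S z by have := seg (Ordinal N0) 0; rewrite lexx ler01 scale0r addr0; apply.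
have Sx j : S (x j).
  by have := seg j 1; rewrite ler01 lexx scale1r addrC subrK; apply.
pose c := functional_coef a z w.
pose pt := @functional_pt R d k z N x.
have ptP i : S (pt i).2 /\ (msize (pt i).1 <= r)%N.
  case: i => [al|j]; rewrite /pt /=; last by rewrite msize_mi0.
  by split=> //; case: ifPn => [alk|_]; [exact: leq_trans kr | rewrite msize_mi0].
pose E (h : index * V -> R) := \sum_i c i * h (pt i).
rewrite gformE; apply: le_trans (ler_norm _) _.
pose g1 al y := E (fun t => kpartial al t.1 K y t.2).
rewrite -/c -/pt.
have -> : \sum_i c i * (\sum_j c j * gramK (g0 K) (pt i) (pt j)) =
    E (fun t => g1 t.1 t.2) by [].
rewrite /E /c /pt (sum_functional a z x w (fun t => g1 t.1 t.2)).
have inner i (s : R) : 0 <= s <= 1 ->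
    `|E (fun t => dirsum r r (x i - z) (fun al => kpartial al t.1 K (z + s *: (x i - z)) t.2 -
                                              kpartial al t.1 K z t.2))| <=
    Q * n i * T / P * s `^ gam.
  move=> s01; pose h be y := dirsum r r (x i - z) (fun al =>
      kpartial al be K (z + s *: (x i - z)) y - kpartial al be K z y).
  rewrite /E /c /pt (sum_functional a z x w (fun t => h t.1 t.2)) /=.
  apply: le_trans (taylor_functional_bound (r := r) (gam := gam)
    (B := fun j => Q * (n i * s `^ gam) * n j) kr gam0 wex _ _ _) _.
  - apply: smooth_on_sum => al /eqP alr; apply: smooth_on_sub.
      by apply: kernel_smooth_on2; [exact: seg | rewrite alr].
    by apply: kernel_smooth_on2; rewrite ?alr.
  - by move=> j; rewrite !mulr_ge0// powR_ge0.
  - move=> j t t01; rewrite -mulrA; move: (H i j s t s01 t01).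
    rewrite (_ : dirsum r r (x i - z) _ =
      dirsum r r (x j - z) (fun al => h al (z + t *: (x j - z))) -
      dirsum r r (x j - z) (fun al => h al z))//.
    rewrite -dirsum_sub /dirsum.
    under eq_bigr do rewrite mulr_sumr.
    under [RHS]eq_bigr do rewrite -sumrB mulr_sumr.
    rewrite exchange_big; apply: eq_bigr => al _; apply: eq_bigr => be _ /=.
    by rewrite /kernel_diff; ring.
  rewrite le_eqVlt; apply/orP; left; apply/eqP; rewrite /T -/P.
  rewrite mulr_sumr !mulr_suml; apply: eq_bigr => j _; ring.
apply: le_trans (taylor_functional_bound (r := r) (gam := gam)
    (B := fun i => Q * n i * T / P) kr gam0 wex _ _ _) _.
- apply: (@smooth_on_sum _ _ r S _ xpredT c (fun i al y => kpartial al (pt i).1 K y (pt i).2)) => i _.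
  by have [] := ptP i; exact: kernel_smooth_on1.
- move=> i; rewrite !mulr_ge0 ?invr_ge0 ?(ltW P0)//; apply: sumr_ge0 => j _.
  by rewrite mulr_ge0.
- move=> i s s01; apply: le_trans (inner i s s01).
  rewrite le_eqVlt; apply/orP; left; apply/eqP; congr `|_|.
  rewrite -dirsum_sub /E -(dirsum_sum _ _ _ c (fun i' al =>
    kpartial al (pt i').1 K (z + s *: (x i - z)) (pt i').2 -
    kpartial al (pt i').1 K z (pt i').2)).
  congr (dirsum _ _ _ _); apply/funext => al; rewrite /g1 /E -sumrB.
  by apply: eq_bigr => i' _; rewrite mulrBr.
rewrite le_eqVlt; apply/orP; left; apply/eqP; rewrite -/P.
rewrite (eq_bigr (fun j => (`|w j| * n j) * (Q * T / P / P))); last by move=> j _; ring.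
by rewrite -mulr_suml -/T; field; rewrite gt_eqF.
Qed.

End DoubleTaylor.

(** * From the kernel seminorm to bounds on directional derivatives *)

Section Seminorm.
Context {R : realType} {d : nat}.
Local Notation V := 'rV[R]_d.
Local Notation index := ('I_d -> nat).
Local Notation o := (@mi0 d).
Implicit Types (u v : V).

Lemma norm2_ge0 u : 0 <= norm2 u.
Proof. exact: sqrtr_ge0. Qed.

Lemma norm2_sqr u : norm2 u ^+ 2 = \sum_i u ord0 i ^+ 2.
Proof. by rewrite sqr_sqrtr// sumr_ge0// => i _; exact: sqr_ge0. Qed.

Lemma norm2_gt0 u : u != 0 -> 0 < norm2 u.
Proof.
move=> u0; rewrite lt_neqAle norm2_ge0 andbT eq_sym; apply: contra u0 => /eqP n0.
have : \sum_i u ord0 i ^+ 2 = 0 by rewrite -norm2_sqr n0 expr0n.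
move=> /eqP; rewrite psumr_eq0; last by move=> i _; exact: sqr_ge0.
move=> /allP H; apply/eqP/rowP => i; rewrite mxE; apply/eqP.
by have := H i; rewrite mem_index_enum sqrf_eq0 => /(_ isT).
Qed.

Lemma norm2Z (s : R) u : 0 <= s -> norm2 (s *: u) = s * norm2 u.
Proof.
move=> s0; rewrite /norm2 -[s in RHS](ger0_norm s0) -sqrtr_sqr -sqrtrM ?sqr_ge0//.
by rewrite mulr_sumr; congr Num.sqrt; apply: eq_bigr => i _; rewrite mxE exprMn.
Qed.

Lemma kseminorm0_ge0 (S : set V) z gam U : (0 <= kseminorm0 S z gam U)%E.
Proof. by apply: ereal_sup_ubound; left. Qed.

(** Points equal to [z] are excluded from the supremum, but there the mixed difference is zero. *)
Lemma kseminorm0_bound (S : set V) z gam (U : V -> V -> R) x y :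
  (kseminorm0 S z gam U < +oo)%E -> S x -> S y ->
  `|U x y - U x z - U z y + U z z| <=
  fine (kseminorm0 S z gam U) * (norm2 (x - z) `^ gam * norm2 (y - z) `^ gam).
Proof.
move=> fin Sx Sy.
have fnum : kseminorm0 S z gam U \is a fin_num by rewrite ge0_fin_numE ?kseminorm0_ge0.
have rhs0 : 0 <= fine (kseminorm0 S z gam U) * (norm2 (x - z) `^ gam * norm2 (y - z) `^ gam).
  by rewrite !mulr_ge0 ?powR_ge0// fine_ge0// kseminorm0_ge0.
have [xz|xz] := eqVneq x z.
  by move: rhs0; rewrite xz (_ : _ - _ - _ + _ = 0) ?normr0//; ring.
have [yz|yz] := eqVneq y z.
  by move: rhs0; rewrite yz (_ : _ - _ - _ + _ = 0) ?normr0//; ring.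
rewrite -ler_pdivrMr; last first.
  by rewrite mulr_gt0// powR_gt0// norm2_gt0// subr_eq0.
rewrite -lee_fin fineK//; apply: ereal_sup_ubound; right.
by exists (x, y).
Qed.

Lemma multinom_gt0 (al : index) : 0 < multinom al :> R.
Proof.
rewrite /multinom divr_gt0// ltr0n ?fact_gt0// prodn_gt0// => i; exact: fact_gt0.
Qed.

(** Multinomial coefficients are positive, so one infinite summand would make the seminorm infinite;
    hence every entry is real. For [r = 0] the formula has a single multi-index and an empty
    product. *)
Lemma kseminormE (S : set V) z r gam (K : V -> V -> R) : 0 < gam ->
  (kseminorm S z r gam K < +oo)%E ->
  exists kap : {ffun 'I_d -> 'I_r.+1} -> {ffun 'I_d -> 'I_r.+1} -> R,
  (forall al be, msize (mi al) = r -> msize (mi be) = r -> forall x y, S x -> S y ->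
     `|kernel_diff K z (mi al) (mi be) x y| <=
     kap al be * (norm2 (x - z) `^ gam * norm2 (y - z) `^ gam)) /\
  kseminorm S z r gam K =
    (Num.sqrt (\sum_(al | msize (mi al) == r) \sum_(be | msize (mi be) == r)
       multinom (mi al) * multinom (mi be) * kap al be ^+ 2) /
     (\prod_(1 <= j < r.+1) (gam + j%:R)) ^+ 2)%:E.
Proof.
move=> gam0 fin; exists (fun al be => fine (kseminorm0 S z gam (kpartial (mi al) (mi be) K))).
case: r fin => [|r] fin.
  have al0 (al : {ffun 'I_d -> 'I_1}) : mi al = o.
    by apply/funext => i; rewrite /mi; case: (al i) => -[].
  have K00 : kpartial o o K = K.
    by apply/funext => y; apply/funext => y'; rewrite /kpartial !partial0.
  split=> [al be _ _ x y Sx Sy|].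
    by rewrite !al0 /kernel_diff; apply: kseminorm0_bound => //; rewrite K00.
  have sum1 (F : {ffun 'I_d -> 'I_1} -> R) : \sum_(al | msize (mi al) == 0%N) F al = F [ffun=> ord0].
    rewrite (big_pred1 [ffun=> ord0])// => al /=; rewrite al0 msize_mi0.
    by apply/esym/eqP/ffunP => i; rewrite !ord1.
  rewrite big_geq// !sum1 !al0 K00 expr1n divr1 /multinom msize_mi0 big1// divr1 !mul1r.
  rewrite sqrtr_sqr ger0_norm ?fine_ge0 ?kseminorm0_ge0// fineK//.
  by rewrite ge0_fin_numE ?kseminorm0_ge0.
set P := \prod_(_ <= _ < _) _.
have P0 : 0 < P by apply: prodr_gt0 => j _; rewrite ltr_wpDr.
move: fin; rewrite /kseminorm prodrXl -/P.
set G := fun al be : {ffun 'I_d -> 'I_r.+2} =>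
  kseminorm0 S z gam (kpartial (mi al) (mi be) K).
set Sum := (\sum_(al | _) _)%E => fin.
have G0 al be : (0 <= G al be)%E by exact: kseminorm0_ge0.
have t0 al be : (0 <= (multinom (mi al) * multinom (mi be))%:E * G al be ^+ 2)%E.
  by rewrite mule_ge0 ?expe_ge0// lee_fin mulr_ge0// ltW// multinom_gt0.
have Sum0 : (0 <= Sum)%E by apply: sume_ge0 => al _; apply: sume_ge0 => be _; exact: t0.
have Sumfin : Sum \is a fin_num.
  rewrite ge0_fin_numE// ltey; apply/eqP => Sumy; move: fin; rewrite Sumy /=.
  by rewrite gt0_muley ?ltxx// lte_fin invr_gt0 exprn_gt0.
have Gfin al be : msize (mi al) = r.+1 -> msize (mi be) = r.+1 -> G al be \is a fin_num.
  move=> /eqP alr /eqP ber; have /sum_fin_numP/(_ al (mem_index_enum _) alr) := Sumfin.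
  move=> /sum_fin_numP/(_ be (mem_index_enum _) ber).
  rewrite -/(G al be); have := G0 al be; case: (G al be) => [//|_|//].
  by rewrite expe2 mulyy gt0_muley// lte_fin mulr_gt0// multinom_gt0.
split=> [al be alr ber x y Sx Sy|].
  by apply: kseminorm0_bound => //; have := Gfin al be alr ber; rewrite ge0_fin_numE.
have -> : Sum = (\sum_(al | msize (mi al) == r.+1) \sum_(be | msize (mi be) == r.+1)
       multinom (mi al) * multinom (mi be) * fine (G al be) ^+ 2)%:E.
  rewrite -sumEFin; apply: eq_bigr => al /eqP alr; rewrite -sumEFin.
  apply: eq_bigr => be /eqP ber; rewrite [in RHS]EFinM EFin_expe fineK//; exact: Gfin.
by rewrite /= -EFinM mulrC.
Qed.

(** Cauchy-Schwarz with multinomial weights separates [kap] from the monomials, whose weighted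
    squares sum to powers of the Euclidean norms. *)
Lemma dirsum_kernel_bound r (D : index -> index -> R) u v c
    (kap : {ffun 'I_d -> 'I_r.+1} -> {ffun 'I_d -> 'I_r.+1} -> R) : 0 <= c ->
  (forall al be : {ffun 'I_d -> 'I_r.+1}, msize (mi al) = r -> msize (mi be) = r ->
     `|D (mi al) (mi be)| <= kap al be * c) ->
  `|dirsum r r u (fun al => dirsum r r v (fun be => D al be))| <=
  Num.sqrt (\sum_(al | msize (mi al) == r) \sum_(be | msize (mi be) == r)
       multinom (mi al) * multinom (mi be) * kap al be ^+ 2) *
  (norm2 u ^+ r * norm2 v ^+ r) * c.
Proof.
move=> c0 HD.
pose I := ({ffun 'I_d -> 'I_r.+1} * {ffun 'I_d -> 'I_r.+1})%type.
pose Q (i : I) := (msize (mi i.1) == r) && (msize (mi i.2) == r).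
pose W (i : I) : R := multinom (mi i.1) * multinom (mi i.2).
pose y (i : I) : R := `|monomial (mi i.1) u| * `|monomial (mi i.2) v|.
have W0 i : 0 <= W i by rewrite mulr_ge0// ltW// multinom_gt0.
have lhs : `|dirsum r r u (fun al => dirsum r r v (fun be => D al be))| <=
    (\sum_(i | Q i) W i * (kap i.1 i.2 * y i)) * c.
  rewrite /dirsum; under eq_bigr do rewrite mulr_sumr.
  rewrite pair_big_dep /= (le_trans (ler_norm_sum _ _ _))// mulr_suml.
  apply: ler_sum => -[al be] /= /andP[/eqP alr /eqP ber].
  have h := HD al be alr ber; rewrite /W /y /=.
  move: (multinom_gt0 (mi al)) (multinom_gt0 (mi be)).
  move: (multinom (mi al)) (multinom (mi be)) => b b' b0 b0'.
  rewrite !normrM (gtr0_norm b0) (gtr0_norm b0').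
  rewrite [leRHS](_ : _ = b * `|monomial (mi al) u| *
    (b' * `|monomial (mi be) v| * (kap al be * c))); last by ring.
  by rewrite !ler_wpM2l// mulr_ge0// ltW.
apply: le_trans lhs _; rewrite ler_wpM2r//.
have sq (t : V) : \sum_(al : {ffun 'I_d -> 'I_r.+1} | msize (mi al) == r)
    multinom (mi al) * `|monomial (mi al) t| ^+ 2 = (norm2 t ^+ r) ^+ 2.
  rewrite [RHS]exprAC norm2_sqr.
  have := multinomial_theorem (\row_i t ord0 i ^+ 2) (leqnn r).
  under [X in _ = X ^+ _]eq_bigr do rewrite mxE.
  move=> <-; apply: eq_bigr => al _; congr (_ * _); rewrite real_normK ?num_real//.
  by rewrite /monomial -prodrXl; apply: eq_bigr => i _; rewrite mxE exprAC.
have := weighted_cauchy_schwarz (P := Q) (fun i => kap i.1 i.2) y (fun i _ => W0 i).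
have -> : \sum_(i | Q i) W i * y i ^+ 2 = (norm2 u ^+ r * norm2 v ^+ r) ^+ 2.
  transitivity (\sum_(al : {ffun 'I_d -> 'I_r.+1} | msize (mi al) == r)
      \sum_(be : {ffun 'I_d -> 'I_r.+1} | msize (mi be) == r)
      multinom (mi al) * multinom (mi be) *
      (`|monomial (mi al) u| * `|monomial (mi be) v|) ^+ 2); first by rewrite pair_big_dep.
  rewrite exprMn -!sq mulr_suml.
  by apply: eq_bigr => al _; rewrite mulr_sumr; apply: eq_bigr => be _; ring.
have -> : \sum_(i | Q i) W i * kap i.1 i.2 ^+ 2 =
    \sum_(al | msize (mi al) == r) \sum_(be | msize (mi be) == r)
       multinom (mi al) * multinom (mi be) * kap al be ^+ 2 by rewrite pair_big_dep.
set A := \sum_(al | _) _ => CS.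
have n0 : 0 <= norm2 u ^+ r * norm2 v ^+ r by rewrite mulr_ge0 ?exprn_ge0 ?norm2_ge0.
rewrite (le_trans (ler_norm _))// -sqrtr_sqr (le_trans (ler_wsqrtr CS))//.
rewrite sqrtrM ?sqrtr_sqr ?(ger0_norm n0)//.
apply: sumr_ge0 => al _; apply: sumr_ge0 => be _.
by rewrite mulr_ge0 ?sqr_ge0// mulr_ge0// ltW// multinom_gt0.
Qed.

End Seminorm.

(** * Weights realizing the growth function, and exactness of the kernel weights *)

Section Growth.
Context {R : realType} {d : nat}.
Local Notation V := 'rV[R]_d.
Local Notation o := (@mi0 d).

(** Duality needs a vector space on which [D] is linear. Coefficient families serve, because [fam]
    attaches genuine derivatives to them. *)
Lemma growth_weights q k (a : {ffun 'I_d -> 'I_k.+1} -> V -> R) (z : V) N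
    (x : 'I_N -> V) (mu : R) :
  growth q a z x mu != +oo%E ->
  exists rho (w : 'I_N -> R), [/\ growth q a z x mu = rho%:E, 0 <= rho,
    forall p, polyspace q p -> \sum_j w j * p (x j) = diffop a p z &
    \sum_j `|w j| * norm2 (x j - z) `^ mu <= rho].
Proof.
move=> gfin.
pose coefs := {ffun {ffun 'I_d -> 'I_q.+1} -> R^o}.
pose fam (c : coefs) be y := \sum_(al : {ffun 'I_d -> 'I_q.+1} | (msize (mi al) < q)%N)
   c al * sepoly (fun i => 'X^(mi al i)) be y : R.
have famj c : jet (fam c) by apply: jet_sum => al; exact: sepoly_jet.
have famlin be y : scalar (fun c => fam c be y).
  move=> b u v; rewrite /fam mulr_sumr -big_split; apply: eq_bigr => al _ /=.
  by rewrite !ffunE /= mulrDl mulrA.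
have famP c : polyspace q (fam c o).
  by exists c => y; apply: eq_bigr => al _; rewrite monomialE.
have famE p : polyspace q p -> exists c, p = fam c o.
  move=> [c pE]; exists (finfun c); apply/funext => y; rewrite pE.
  by apply: eq_bigr => al _; rewrite monomialE ffunE.
have dlin : scalar (fun c => diffop a (fam c o) z).
  move=> b u v; rewrite !diffop_jet// mulr_sumr -big_split; apply: eq_bigr => al _ /=.
  by rewrite (famlin (mi al) z b u v); ring.
have ub p : polyspace q p -> (forall j, `|p (x j)| <= norm2 (x j - z) `^ mu) ->
    ((diffop a p z)%:E <= growth q a z x mu)%E.
  by move=> pq pb; apply: ereal_sup_ubound; exists p.
have fam0 y : fam 0 o y = 0 by have [] := scalar_facts (famlin o y).
have d0 : diffop a (fam 0 o) z = 0 by have [] := scalar_facts dlin.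
have g0 : (0 <= growth q a z x mu)%E.
  by have := ub _ (famP 0); rewrite d0; apply=> j; rewrite fam0 normr0 powR_ge0.
have gf : growth q a z x mu \is a fin_num by rewrite ge0_fin_numE// ltey.
have [||||w [wL wc]] := @linear_sum_duality R coefs N (fun j c => fam c o (x j))
   (fun j => norm2 (x j - z) `^ mu) (fun c => diffop a (fam c o) z) (fine (growth q a z x mu)).
- by move=> j; exact: famlin.
- exact: dlin.
- by move=> j; exact: powR_ge0.
- by move=> c H; rewrite -lee_fin fineK//; exact: ub.
exists (fine (growth q a z x mu)), w; split=> //.
- by rewrite fineK.
- by rewrite fine_ge0.
- by move=> p /famE[c ->]; rewrite wL.
Qed.

(** Linearity of [diffop] rests on genuine derivatives, so it is checked on [jet] representations of
    the basis. *)
Lemma kernel_weights_exact s k (a : {ffun 'I_d -> 'I_k.+1} -> V -> R) K (z : V) N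
    (x : 'I_N -> V) M (p : 'I_M -> V -> R) w :
  polybasis s p -> kernel_weights a K z x p w ->
  forall q, polyspace s q -> \sum_j w j * q (x j) = diffop a q z.
Proof.
move=> [pP pspan _] [_ [_ wE]] q /pspan[c qE].
have Hg l : exists g, jet g /\ p l = g o by have [g] := polyspaceP (pP l); exists g.
have [g gE] := choice Hg.
have gj l : jet (g l) by have [] := gE l.
have -> : q = (fun y => \sum_l c l * g l o y).
  by apply/funext => y; rewrite qE; apply: eq_bigr => l _; have [_ ->] := gE l.
rewrite (diffop_jet a z (jet_sum xpredT c gj)).
under [RHS]eq_bigr do rewrite mulr_sumr.
rewrite [RHS]exchange_big /=.
under [LHS]eq_bigr do rewrite mulr_sumr.
rewrite [LHS]exchange_big /=; apply: eq_bigr => l _.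
rewrite (eq_bigr (fun j => c l * (w j * p l (x j)))); last first.
  by move=> j _; have [_ ->] := gE l; rewrite mulrCA.
rewrite -mulr_sumr wE; have [_ ->] := gE l; rewrite diffop_jet// mulr_sumr.
by apply: eq_bigr => al _; rewrite mulrCA.
Qed.

End Growth.

(** * The error estimate *)

Unset Implicit Arguments.
Set Strict Implicit.
Set Printing Implicit Defensive.

Theorem theorem1 (R : realType) (d : nat) (hd : (0 < d)%N)
    (k : nat) (a : {ffun 'I_d -> 'I_k.+1} -> 'rV[R]_d -> R)
    (s : nat) (Om : set 'rV[R]_d) (K : 'rV[R]_d -> 'rV[R]_d -> R)
    (hOm : domain Om) (hKsym : symmetric_on Om K) (hKpd : cond_posdef s Om K)
    (z : 'rV[R]_d) (hz : Om z)
    (N : nat) (hN : (0 < N)%N) (x : 'I_N -> 'rV[R]_d) (hx : injective x)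
    (hS : star z x `<=` Om)
    (hex : exists w : 'I_N -> R, forall p, polyspace s p ->
       \sum_(j < N) w j * p (x j) = diffop a p z)
    (r : nat) (hr : (k <= r)%N) (gam : R) (hgam : 0 < gam <= 1)
    (hKr : has_continuous_kpartials r (star z x) K)
    (hKfin : (kseminorm (star z x) z r gam K < +oo)%E)
    (M : nat) (p : 'I_M -> 'rV[R]_d -> R) (hp : polybasis s p)
    (w : 'I_N -> R) (hw : kernel_weights a K z x p w)
    (f : 'rV[R]_d -> R) (hf : native_space s Om K f) :
  has_partials k f z /\
  (growth (maxn s r.+1) a z x (r%:R + gam) != +oo%E ->
   ((`|diffop a f z - \sum_(j < N) w j * f (x j)|)%:E <=
    growth (maxn s r.+1) a z x (r%:R + gam)
      * sqrte (kseminorm (star z x) z r gam K)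
      * (native_norm s Om K f)%:E)%E).
Proof.
have gam0 : 0 < gam by case/andP: hgam.
have wex := kernel_weights_exact hp hw.
have seg := @star_segment R d z N x.
have nodeS : range (node z x) `<=` star z x.
  move=> _ [[j|] _ <-] /=.
    by have := seg j 1; rewrite ler01 lexx scale1r addrC subrK; apply.
  by have := seg (Ordinal hN) 0; rewrite lexx ler01 scale0r addr0; apply.
have nodeOm j : Om (node z x j) by apply/hS/nodeS; exists j.
have hKn : has_continuous_kpartials r (range (node z x)) K.
  by move=> y y' Sy Sy'; apply: hKr; exact: nodeS.
have bound C := fun fC : native_le s Om K f C =>
  native_bound hOm.1 fC hr nodeOm hKn hp wex.
split; first by have [C fC] := hf; exact: (bound C fC).1.
move=> /growth_weights[rho [w' [-> rho0 w'ex w'rho]]].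
have w'exs q : polyspace s q -> \sum_j w' j * q (x j) = diffop a q z.
  by move=> /(polyspace_le (leq_maxl s r.+1)); exact: w'ex.
have w'exr q : polyspace r.+1 q -> \sum_j w' j * q (x j) = diffop a q z.
  by move=> /(polyspace_le (leq_maxr s r.+1)); exact: w'ex.
have [kap [kapP kapE]] := kseminormE gam0 hKfin.
rewrite kapE; set Q := Num.sqrt (\sum_(al | _) _) in kapE *.
set P := \prod_(_ <= _ < _) _ in kapE *.
have P0 : 0 < P by apply: prodr_gt0 => j _; rewrite ltr_wpDr.
have opt := kernel_weights_optimal hOm.1 hKsym hKpd hx nodeOm hp hw wex w'exs.
have QP0 : 0 <= Q / P ^+ 2 by rewrite divr_ge0 ?sqrtr_ge0// exprn_ge0// ltW.
pose n j := norm2 (x j - z) `^ (r%:R + gam).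
have nE j : n j = norm2 (x j - z) ^+ r * norm2 (x j - z) `^ gam.
  rewrite /n powRD ?powR_mulrn ?norm2_ge0//.
  by apply/implyP => /eqP e; have := ler0n R r; have := gam0; lra.
have taylor : gform (functional_coef a z w') (functional_pt z x)
    (gramK (fun al be x y => kpartial al be K x y)) <=
    Q / P ^+ 2 * (\sum_j `|w' j| * n j) ^+ 2.
  apply: gform_taylor_bound => //; first exact: sqrtr_ge0.
    by move=> j; exact: powR_ge0.
  move=> i j t t' t01 t01'.
  have [t0 _] := andP t01; have [t'0 _] := andP t01'.
  (* At parameter [t] the distance to [z] is [t] times [norm2 (x i - z)]; its power [gam] joins the
     power [r] from the directional derivatives to form [n i]. *)
  apply: le_trans (dirsum_kernel_bound _ _ (kap := kap)
    (c := (t * norm2 (x i - z)) `^ gam * (t' * norm2 (x j - z)) `^ gam) _ _) _.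
  - by rewrite mulr_ge0 ?powR_ge0.
  - move=> al be alr ber; have := kapP al be alr ber _ _ (seg i t t01) (seg j t' t01').
    by rewrite -!norm2Z// ![z + _]addrC !addrK.
  rewrite -/Q !powRM ?norm2_ge0// !nE le_eqVlt; apply/orP; left; apply/eqP; ring.
have main C : native_le s Om K f C ->
    `|diffop a f z - \sum_j w j * f (x j)| <= rho * Num.sqrt (Q / P ^+ 2) * C.
  move=> fC; have [C0 _] := fC; rewrite (le_trans (bound C fC).2)// mulrC ler_wpM2r//.
  rewrite (le_trans (ler_wsqrtr (le_trans opt taylor)))// sqrtrM// sqrtr_sqr mulrC.
  rewrite ler_wpM2r ?sqrtr_ge0// ger0_norm//.
  by apply: sumr_ge0 => j _; rewrite mulr_ge0 ?powR_ge0.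
rewrite /= -!EFinM lee_fin.
set X := rho * _ in main *.
have X0 : 0 <= X by rewrite mulr_ge0 ?sqrtr_ge0.
have [C fC] := hf.
(* If the factor [X] is zero, any admissible [C] already gives the bound zero; otherwise division by
   [X] makes the error quotient a lower bound of all admissible [C], hence of their infimum. *)
move: X0; rewrite le_eqVlt => /orP[/eqP X0|X0].
  by have := main C fC; rewrite -X0 !mul0r.
rewrite mulrC -ler_pdivrMr//; apply: lb_le_inf; first by exists C.
by move=> C' fC'; rewrite ler_pdivrMr// mulrC; exact: main.
Qed.
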